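(* On trees with $n$ vertices, \textsc{Min Edge Deletion Bounded-Density} can be solved in time $O(n^3)$.
   Context: All graphs are finite, simple and undirected. The density of a graph $H$ is $\rho(H)=|E(H)|/|V(H)|$ (the empty graph has density $0$), and $\rho^*(G)=\max_{H\subseteq G}\rho(H)$. For $F\subseteq E(G)$, $G-F$ is the graph obtained by removing the edges in $F$. \textsc{Min Edge Deletion Bounded-Density}: given a graph $G$ and a rational $\tau_\rho\ge 0$, compute a minimum-size set $F\subseteq E(G)$ such that $\rho^*(G-F)\le\tau_\rho$. *)

(* Defs.v *)
From HB Require Import structures.
From mathcomp Require Import all_boot all_order all_algebra.

Set Implicit Arguments.
Unset Strict Implicit.
Unset Printing Implicit Defensive.

Import Order.TTheory GRing.Theory Num.Theory.

(* A graph whose vertices are drawn from a finite type T is a pair (V, E);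
   each edge is a two-element subset of V. *)

Section Graphs.
Variable T : finType.

Definition wf_graph (VE : {set T} * {set {set T}}) : bool :=
  [forall e in VE.2, (e \subset VE.1) && (#|e| == 2)].

Record graph : Type := Graph { graph_val : {set T} * {set {set T}};
                               graphP : wf_graph graph_val }.

HB.instance Definition _ := [isSub for graph_val].
HB.instance Definition _ := [Finite of graph by <:].

Definition vertices (G : graph) : {set T} := (graph_val G).1.
Definition edges (G : graph) : {set {set T}} := (graph_val G).2.

Definition subgraph (H G : graph) : bool :=
  (vertices H \subset vertices G) && (edges H \subset edges G).

Lemma wf_del_edges (G : graph) (F : {set {set T}}) :
  wf_graph (vertices G, edges G :\: F).
Proof.
apply/forall_inP => e /=; rewrite inE => /andP[_ eG].
by move/forall_inP: (graphP G) => /(_ e eG).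
Qed.

Definition del_edges (G : graph) (F : {set {set T}}) : graph :=
  Graph (wf_del_edges G F).

(* 0 for the graph without vertices, since x / 0 = 0 in rat. *)
Definition density (H : graph) : rat := (#|edges H|%:R / #|vertices H|%:R)%R.

(* The unit 0 of the iterated maximum is itself a value in the range: it is
   the density of the empty subgraph. *)
Definition max_density (G : graph) : rat :=
  \big[Order.max/0%R]_(H : graph | subgraph H G) density H.

Definition adj (G : graph) : rel T := fun x y => [set x; y] \in edges G.

Definition connected (G : graph) : Prop :=
  vertices G != set0 /\ {in vertices G &, forall x y, connect (adj G) x y}.

Definition acyclic (G : graph) : Prop :=
  forall s : seq T, 2 < size s -> ~ ucycle (adj G) s.

Definition is_tree (G : graph) : Prop := connected G /\ acyclic G.

Definition bounded_density_deletion (G : graph) (tau : rat)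
    (F : {set {set T}}) : Prop :=
  F \subset edges G /\ (max_density (del_edges G F) <= tau)%R.

Definition min_edge_deletion_bounded_density (G : graph) (tau : rat)
    (F : {set {set T}}) : Prop :=
  bounded_density_deletion G tau F /\
  forall F' : {set {set T}}, bounded_density_deletion G tau F' -> #|F| <= #|F'|.

End Graphs.

(* The random access machine of Cook and Reckhow (Time bounded random access
   machines, 1973), over the natural numbers: subtraction is truncated. The
   memory cells X_0, X_1, ... are initially 0, the input is read from and the
   output written to a sequential tape, and every instruction costs one step.
   There is no multiplication, so that the unit-cost measure is a reasonable
   one: a value grows by at most one bit per step. *)

Inductive instr : Type :=
  | IConst of nat & nat         (* X_i <- c *)
  | IAdd of nat & nat & nat     (* X_i <- X_j + X_k *)
  | ISub of nat & nat & nat     (* X_i <- X_j - X_k *)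
  | ILoad of nat & nat          (* X_i <- X_(X_j) *)
  | IStore of nat & nat         (* X_(X_i) <- X_j *)
  | IJpos of nat & nat          (* if X_j > 0 then go to instruction l *)
  | IRead of nat                (* X_i <- next input number, 0 if none is left *)
  | IPrint of nat.              (* append X_i to the output *)

Definition program := seq instr.

Record state : Type := State { pc : nat;
                               mem : nat -> nat;
                               inp : seq nat;
                               out : seq nat }.

Definition upd (m : nat -> nat) (i v : nat) : nat -> nat :=
  fun a => if a == i then v else m a.

Definition exec (c : instr) (s : state) : state :=
  let: State p m r w := s in
  match c with
  | IConst i v => State p.+1 (upd m i v) r w
  | IAdd i j k => State p.+1 (upd m i (m j + m k)) r w
  | ISub i j k => State p.+1 (upd m i (m j - m k)) r w
  | ILoad i j  => State p.+1 (upd m i (m (m j))) r w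
  | IStore i j => State p.+1 (upd m (m i) (m j)) r w
  | IJpos j l  => State (if 0 < m j then l else p.+1) m r w
  | IRead i    => State p.+1 (upd m i (head 0 r)) (behead r) w
  | IPrint i   => State p.+1 m r (rcons w (m i))
  end.

(* The machine halts when pc points outside the program; such states are fixed
   by step. *)
Definition halted (P : program) (s : state) : bool := size P <= pc s.

Definition step (P : program) (s : state) : state :=
  if onth P (pc s) is Some c then exec c s else s.

Definition init (x : seq nat) : state := State 0 (fun=> 0) x [::].

Definition outputs_within (P : program) (x : seq nat) (t : nat) (y : seq nat)
    : Prop :=
  let s := iter t (step P) (init x) in halted P s /\ out s = y.

Definition bigO (f g : nat -> nat) : Prop :=
  exists c n0 : nat, forall n, n0 <= n -> f n <= c * g n.

Section Encodings.
Variable n : nat.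

(* s lists every edge of F exactly once, in any order and with either order of
   the endpoints. *)
Definition edge_list (F : {set {set 'I_n}}) (s : seq ('I_n * 'I_n)) : Prop :=
  perm_eq [seq [set e.1; e.2] | e <- s] (enum F).

Definition endpoints (s : seq ('I_n * 'I_n)) : seq nat :=
  flatten [seq [:: val e.1; val e.2] | e <- s].

Definition encodes_edges (F : {set {set 'I_n}}) (y : seq nat) : Prop :=
  exists2 s, edge_list F s & y = endpoints s.

(* The graph has vertex set {0, ..., n-1}; the fraction p / q need not be in
   lowest terms. *)
Definition encodes_instance (G : graph 'I_n) (tau : rat) (x : seq nat) : Prop :=
  vertices G = [set: 'I_n] /\
  exists s : seq ('I_n * 'I_n), exists p q : nat,
    [/\ edge_list (edges G) s, 0 < q, tau = (p%:R / q%:R)%R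
      & x = [:: n; #|edges G|; p; q] ++ endpoints s].

End Encodings.

(* Main.v *)
Require Import Defs.
From mathcomp Require Import all_boot all_order all_algebra zify.

Set Implicit Arguments.
Unset Strict Implicit.
Unset Printing Implicit Defensive.

Import Order.TTheory GRing.Theory Num.Theory.

(** A forest has maximum density (k - 1) / k, where k is the size of its largest
    component, so for tau = p / q the task is to cut as few edges as possible so
    that every component, weighing q - p per vertex, weighs at most q. Root the
    tree and treat the vertices by decreasing depth and, at equal depth, by
    increasing weight: merge a vertex v into its parent u if the merged weight
    is at most q, and cut the edge vu otherwise. A cut is forced. A merge is
    safe: an optimal solution that cuts vu can instead cut a sibling of v that
    it keeps, which is at least as heavy as v, or the edge above u. Selecting
    the next vertex by a linear scan gives O(n^2) steps; the parents are found
    by n passes over the edge list.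

    The machine program is the translation of a program in a small language
    whose only loops run n times, which makes its running time a function of
    its syntax. *)

(** * A loop language and its translation to the machine *)

(* Besides the registers R_i there are arrays A_a; the registers are array 0. *)
Inductive cmd : Type :=
  | CSkip
  | CConst of nat & nat          (* R_i <- c *)
  | CAdd of nat & nat & nat      (* R_i <- R_j + R_k *)
  | CSub of nat & nat & nat      (* R_i <- R_j - R_k *)
  | CLoad of nat & nat & nat     (* R_i <- A_a[R_j] *)
  | CStore of nat & nat & nat    (* A_a[R_i] <- R_j *)
  | CRead of nat
  | CPrint of nat
  | CSeq of cmd & cmd
  | CIf of nat & cmd & cmd       (* tests R_i > 0 *)
  | CFor of nat & cmd.           (* for R_i = R_0 - 1 down to 0 *)

Record store : Type :=
  Store { cell : nat -> nat -> nat; sinp : seq nat; sout : seq nat }.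

Definition upd_cell (c : nat -> nat -> nat) (k i v : nat) : nat -> nat -> nat :=
  fun k' i' => if (k' == k) && (i' == i) then v else c k' i'.

Definition put (s : store) (k i v : nat) : store :=
  Store (upd_cell (cell s) k i v) (sinp s) (sout s).

Definition next_input (s : store) : store :=
  Store (cell s) (behead (sinp s)) (sout s).

Definition emit (s : store) (v : nat) : store :=
  Store (cell s) (sinp s) (rcons (sout s) v).

Lemma cell_put s a i v b j :
  cell (put s a i v) b j = if (b == a) && (j == i) then v else cell s b j.
Proof. by []. Qed.

Lemma cell_next_input s a i : cell (next_input s) a i = cell s a i.
Proof. by []. Qed.

Lemma cell_emit s v a i : cell (emit s v) a i = cell s a i.
Proof. by []. Qed.

Lemma sinp_put s a i v : sinp (put s a i v) = sinp s. Proof. by []. Qed.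

Lemma sinp_next_input s : sinp (next_input s) = behead (sinp s).
Proof. by []. Qed.

Lemma sout_put s a i v : sout (put s a i v) = sout s. Proof. by []. Qed.

Lemma sout_next_input s : sout (next_input s) = sout s. Proof. by []. Qed.

Lemma sout_emit s v : sout (emit s v) = rcons (sout s) v. Proof. by []. Qed.

Definition storeE := (cell_put, cell_next_input, cell_emit, sinp_put,
  sinp_next_input, sout_put, sout_next_input, sout_emit).

(* Keeps [/=] from exposing the update functions, so that [storeE] applies. *)
Arguments cell : simpl never.
Arguments sinp : simpl never.
Arguments sout : simpl never.

(* [N] is the constant value of register 0. *)
Fixpoint sem (N : nat) (c : cmd) (s : store) : store :=
  match c with
  | CSkip => s
  | CConst i v => put s 0 i v
  | CAdd i j k => put s 0 i (cell s 0 j + cell s 0 k)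
  | CSub i j k => put s 0 i (cell s 0 j - cell s 0 k)
  | CLoad a i j => put s 0 i (cell s a (cell s 0 j))
  | CStore a i j => put s a (cell s 0 i) (cell s 0 j)
  | CRead i =>
      put (next_input s) 0 i (head 0 (sinp s))
  | CPrint i => emit s (cell s 0 i)
  | CSeq c1 c2 => sem N c2 (sem N c1 s)
  | CIf i c1 c2 => if 0 < cell s 0 i then sem N c1 s else sem N c2 s
  | CFor i c1 =>
      iter N (fun s' => sem N c1 (put s' 0 i (cell s' 0 i - 1))) (put s 0 i N)
  end.

Lemma sem_seq N c1 c2 s : sem N (CSeq c1 c2) s = sem N c2 (sem N c1 s).
Proof. by []. Qed.

(** The index of a store is known only at run time, so a store to array 0 counts as a write to every
    register. *)
Fixpoint keeps (r : nat) (c : cmd) : bool :=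
  match c with
  | CSkip | CPrint _ => true
  | CConst i _ | CAdd i _ _ | CSub i _ _ | CLoad _ i _ | CRead i => i != r
  | CStore a _ _ => a != 0
  | CSeq c1 c2 | CIf _ c1 c2 => keeps r c1 && keeps r c2
  | CFor i c1 => (i != r) && keeps r c1
  end.

(** Array 7 is left to the scratch space of the translation. A loop body may not write its own
    counter, since the compiled loop stops when the counter is 0 whereas [sem] iterates [N]
    times. *)
Fixpoint wf_cmd (c : cmd) : bool :=
  match c with
  | CLoad a _ _ | CStore a _ _ => a < 7
  | CSeq c1 c2 | CIf _ c1 c2 => wf_cmd c1 && wf_cmd c2
  | CFor i c1 => keeps i c1 && wf_cmd c1
  | _ => true
  end.

Fixpoint code_size (c : cmd) : nat :=
  match c with
  | CSkip => 0
  | CConst _ _ | CAdd _ _ _ | CSub _ _ _ | CRead _ | CPrint _ => 1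
  | CLoad _ _ _ | CStore _ _ _ => 6
  | CSeq c1 c2 => code_size c1 + code_size c2
  | CIf _ c1 c2 => code_size c1 + code_size c2 + 3
  | CFor _ c1 => code_size c1 + 5
  end.

(** Adding the costs of both branches of a conditional, instead of taking their maximum, keeps the
    bound a polynomial in [N]. The 3 extra steps per iteration decrement the counter and jump. *)
Fixpoint time_bound (N : nat) (c : cmd) : nat :=
  match c with
  | CSkip => 0
  | CConst _ _ | CAdd _ _ _ | CSub _ _ _ | CRead _ | CPrint _ => 1
  | CLoad _ _ _ | CStore _ _ _ => 6
  | CSeq c1 c2 => time_bound N c1 + time_bound N c2
  | CIf _ c1 c2 => time_bound N c1 + time_bound N c2 + 3
  | CFor _ c1 => 2 + N * (time_bound N c1 + 3)
  end.

(** Without multiplication, the factor 8 comes from three doublings. *)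
Definition address_code (a i : nat) : program :=
  [:: IAdd 7 (8 * i) (8 * i); IAdd 7 7 7; IAdd 7 7 7; IConst 15 a; IAdd 7 7 15].

(* Cell [i] of array [a] lives at address [8 * i + a]; array 0 holds the
   registers, and the cells 7 and 15 of the unused array 7 are scratch space. *)
Fixpoint compile (o : nat) (c : cmd) : program :=
  match c with
  | CSkip => [::]
  | CConst i v => [:: IConst (8 * i) v]
  | CAdd i j k => [:: IAdd (8 * i) (8 * j) (8 * k)]
  | CSub i j k => [:: ISub (8 * i) (8 * j) (8 * k)]
  | CLoad a i j => address_code a j ++ [:: ILoad (8 * i) 7]
  | CStore a i j => address_code a i ++ [:: IStore 7 (8 * j)]
  | CRead i => [:: IRead (8 * i)]
  | CPrint i => [:: IPrint (8 * i)]
  | CSeq c1 c2 => compile o c1 ++ compile (o + code_size c1) c2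
  | CIf i c1 c2 =>
      IJpos (8 * i) (o + code_size c2 + 3) :: compile (o + 1) c2 ++
      [:: IConst 7 1; IJpos 7 (o + code_size c2 + 3 + code_size c1)] ++
      compile (o + code_size c2 + 3) c1
  | CFor i c1 =>
      [:: IConst 7 0; IAdd (8 * i) 0 7; IConst 7 1; ISub (8 * i) (8 * i) 7] ++
      compile (o + 4) c1 ++ [:: IJpos (8 * i) (o + 2)]
  end.

Lemma size_compile (c : cmd) (o : nat) : size (compile o c) = code_size c.
Proof.
elim: c o => //= [c1 IH1 c2 IH2|i c1 IH1 c2 IH2|i c1 IH1] o;
  rewrite !size_cat /= ?size_cat ?IH1 ?IH2 /=; lia.
Qed.

(** * Frame properties and an invariant rule for loops *)

Fixpoint stores_to (a : nat) (c : cmd) : bool :=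
  match c with
  | CStore b _ _ => b == a
  | CSeq c1 c2 | CIf _ c1 c2 => stores_to a c1 || stores_to a c2
  | CFor _ c1 => stores_to a c1
  | _ => false
  end.

Fixpoint prints (c : cmd) : bool :=
  match c with
  | CPrint _ => true
  | CSeq c1 c2 | CIf _ c1 c2 => prints c1 || prints c2
  | CFor _ c1 => prints c1
  | _ => false
  end.

Lemma sem_keeps N r c s : keeps r c -> cell (sem N c s) 0 r = cell s 0 r.
Proof.
have H s' a i v : (a != 0) || (i != r) -> cell (put s' a i v) 0 r = cell s' 0 r.
  by rewrite cell_put; case: ifP => // /andP[/eqP<- /eqP<-]; rewrite !eqxx.
elim: c s => //= [i v|i j k|i j k|a i j|a i j|i|c1 IH1 c2 IH2|i c1 IH1 c2 IH2|i c1 IH] s.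
- by move=> h; apply: (H s 0); rewrite h.
- by move=> h; apply: (H s 0); rewrite h.
- by move=> h; apply: (H s 0); rewrite h.
- by move=> h; apply: (H s 0); rewrite h.
- by move=> h; apply: (H s a); rewrite h.
- by move=> h; apply: (H s 0); rewrite h.
- by move=> /andP[/IH1 h1 /IH2 h2]; rewrite h2.
- by move=> /andP[/IH1 h1 /IH2 h2]; case: ifP.
move=> /andP[hi /IH h].
have -> : cell s 0 r = cell (put s 0 i N) 0 r by rewrite H ?hi.
move: (put s 0 i N) => s1.
(* The number of iterations is separated from the [N] inside the body. *)
by move: {1}N; elim=> //= n <-; rewrite h H ?hi.
Qed.

Lemma sem_array N a c s i : a != 0 -> ~~ stores_to a c ->
  cell (sem N c s) a i = cell s a i.
Proof.
move=> /negPf a0.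
elim: c s => //= [j v|j k l|j k l|b j k|b j k|j|c1 IH1 c2 IH2|j c1 IH1 c2 IH2|j c1 IH] s.
- by rewrite cell_put a0.
- by rewrite cell_put a0.
- by rewrite cell_put a0.
- by rewrite cell_put a0.
- by move=> /negPf ba; rewrite cell_put eq_sym ba.
- by rewrite cell_put a0.
- by rewrite negb_or => /andP[/IH1 h1 /IH2 h2]; rewrite h2.
- by rewrite negb_or => /andP[/IH1 h1 /IH2 h2]; case: ifP.
move=> /IH h; have -> : cell s a i = cell (put s 0 j N) a i by rewrite cell_put a0.
move: (put s 0 j N) => s1.
by move: {1}N; elim=> //= n <-; rewrite h cell_put a0.
Qed.

Lemma sem_silent N c s : ~~ prints c -> sout (sem N c s) = sout s.
Proof.
elim: c s => //= [c1 IH1 c2 IH2|j c1 IH1 c2 IH2|j c1 IH] s.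
- by rewrite negb_or => /andP[/IH1 h1 /IH2 h2]; rewrite h2.
- by rewrite negb_or => /andP[/IH1 h1 /IH2 h2]; case: ifP.
move=> /IH h; have -> : sout s = sout (put s 0 j N) by [].
move: (put s 0 j N) => s1.
by move: {1}N; elim=> //= n <-; rewrite h.
Qed.

(* The counter takes the values [N - 1, ..., 0]: [I r] is the invariant when
   [r] iterations remain. *)
Lemma sem_for N i c (I : nat -> store -> Prop) s : keeps i c ->
  I N (put s 0 i N) ->
  (forall r s', r < N -> cell s' 0 i = r -> I r.+1 s' -> I r (sem N c s')) ->
  (forall r s' v, I r s' -> I r (put s' 0 i v)) ->
  I 0 (sem N (CFor i c) s).
Proof.
move=> ki I0 IS Iput /=.
set f := fun s' => sem N c (put s' 0 i (cell s' 0 i - 1)).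
suff H k : k <= N -> cell (iter k f (put s 0 i N)) 0 i = N - k /\
    I (N - k) (iter k f (put s 0 i N)).
  by have [_] := H N (leqnn N); rewrite subnn.
elim: k=> [|k IH] lt; first by rewrite subn0 cell_put !eqxx.
have [e Ik] := IH (ltnW lt); rewrite iterS.
move: (iter k f _) e Ik => s' e Ik.
have e' : cell (put s' 0 i (cell s' 0 i - 1)) 0 i = N - k.+1.
  by rewrite cell_put !eqxx /= e subn1 subnS.
rewrite /f; split; first by rewrite (sem_keeps _ _ ki) e'.
apply: IS => //; first lia.
by apply: Iput; have -> : (N - k.+1).+1 = N - k by lia.
Qed.

(** * Simulation of the loop language by the machine *)

Definition code_at (P : program) (o : nat) (l : program) : Prop :=
  forall k, k < size l -> onth P (o + k) = onth l k.

Lemma code_at_cat (P : program) (o : nat) (l1 l2 : program) :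
  code_at P o (l1 ++ l2) -> code_at P o l1 /\ code_at P (o + size l1) l2.
Proof.
move=> h; split=> k hk.
  by rewrite h ?size_cat ?onth_cat ?hk //; lia.
rewrite -addnA h ?size_cat ?onth_cat ?ltn_add2l //.
by rewrite ltnNge leq_addr /= addKn.
Qed.

Lemma code_at_cons (P : program) (o : nat) (c : instr) (l : program) :
  code_at P o (c :: l) -> onth P o = Some c /\ code_at P (o + 1) l.
Proof.
move=> h; split; first by rewrite -[o]addn0 h.
by move=> k hk; rewrite -addnA h.
Qed.

Definition represents (m : nat -> nat) (s : store) : Prop :=
  forall a i, a < 7 -> m (8 * i + a) = cell s a i.

(** A store leaves the scratch cells undetermined, hence the quantification over all memories that
    represent it. *)
Definition runs_within (P : program) (T o o' : nat) (s s' : store) : Prop :=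
  forall m, represents m s -> exists t m',
    [/\ t <= T, represents m' s'
      & iter t (step P) (State o m (sinp s) (sout s)) =
        State o' m' (sinp s') (sout s')].

Lemma runs_within_trans (P : program) (T1 T2 o1 o2 o3 : nat) (s1 s2 s3 : store) :
  runs_within P T1 o1 o2 s1 s2 -> runs_within P T2 o2 o3 s2 s3 ->
  runs_within P (T1 + T2) o1 o3 s1 s3.
Proof.
move=> h1 h2 m /h1[t1 [m1 [le1 r1 e1]]].
have [t2 [m2 [le2 r2 e2]]] := h2 _ r1.
by exists (t2 + t1), m2; rewrite iterD e1 e2; split=> //; lia.
Qed.

Lemma runs_within_leq (P : program) (T T' o o' : nat) (s s' : store) :
  T <= T' -> runs_within P T o o' s s' -> runs_within P T' o o' s s'.
Proof.
move=> le h m /h[t [m' [le' r e]]]; exists t, m'; split=> //; lia.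
Qed.

Lemma runs_within_refl (P : program) (T o : nat) (s : store) :
  runs_within P T o o s s.
Proof. by move=> m r; exists 0, m. Qed.

Lemma step_fetch (P : program) (c : instr) (p : nat) m r w :
  onth P p = Some c -> step P (State p m r w) = exec c (State p m r w).
Proof. by rewrite /step /= => ->. Qed.

Lemma represents_reg m s i : represents m s -> m (8 * i) = cell s 0 i.
Proof. by move=> r; rewrite -r // addn0. Qed.

Lemma represents_put m s k i v : k < 7 -> represents m s ->
  represents (upd m (8 * i + k) v) (put s k i v).
Proof.
move=> hk rm a j ha; rewrite cell_put /upd.
have -> : (8 * j + a == 8 * i + k) = (a == k) && (j == i) by lia.
by case: ifP => // _; exact: rm.
Qed.

Lemma represents_scratch m s i v : represents m s ->
  represents (upd m (8 * i + 7) v) s.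
Proof.
move=> rm a j ha; rewrite /upd.
by have -> : (8 * j + a == 8 * i + 7) = false by [lia]; exact: rm.
Qed.

Lemma runs_within_instr (P : program) (c : instr) (o o' : nat) (s s' : store) :
  onth P o = Some c ->
  (forall m, represents m s -> exists2 m', represents m' s' &
     exec c (State o m (sinp s) (sout s)) = State o' m' (sinp s') (sout s')) ->
  runs_within P 1 o o' s s'.
Proof.
move=> hc h m /h[m' r' e]; exists 1, m'; split=> //.
by rewrite /= (step_fetch _ _ _ hc).
Qed.

Lemma exec_address_code P o a i s m : code_at P o (address_code a i) ->
  represents m s -> exists2 m', represents m' s /\ m' 7 = 8 * cell s 0 i + a &
  iter 5 (step P) (State o m (sinp s) (sout s)) =
    State (o + 5) m' (sinp s) (sout s).
Proof.
move=> /code_at_cons[h1 /code_at_cons[h2 /code_at_cons[h3 /code_at_cons[h4]]]].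
move=> /code_at_cons[h5 _] rm.
have sc v m' : represents m' s -> represents (upd m' 7 v) s.
  exact: (represents_scratch 0).
rewrite iterSr (step_fetch _ _ _ h1) /exec -[o.+1]addn1.
set m1 := upd m 7 _; have r1 : represents m1 s by exact: sc.
have e1 : m1 7 = 2 * cell s 0 i by rewrite /m1 /upd eqxx (represents_reg _ rm); lia.
move: m1 r1 e1 => m1 r1 e1 {m rm h1}.
rewrite iterSr (step_fetch _ _ _ h2) /exec -[(o + 1).+1]addn1 e1.
set m2 := upd m1 7 _; have r2 : represents m2 s by exact: sc.
have e2 : m2 7 = 4 * cell s 0 i by rewrite /m2 /upd eqxx; lia.
move: m2 r2 e2 => m2 r2 e2 {m1 r1 e1 h2}.
rewrite iterSr (step_fetch _ _ _ h3) /exec -[(o + 1 + 1).+1]addn1 e2.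
set m3 := upd m2 7 _; have r3 : represents m3 s by exact: sc.
have e3 : m3 7 = 8 * cell s 0 i by rewrite /m3 /upd eqxx; lia.
move: m3 r3 e3 => m3 r3 e3 {m2 r2 e2 h3}.
rewrite iterSr (step_fetch _ _ _ h4) /exec -[(o + 1 + 1 + 1).+1]addn1.
set m4 := upd m3 15 a; have r4 : represents m4 s.
  exact: (represents_scratch 1).
have e4 : m4 7 = 8 * cell s 0 i by rewrite -e3.
have e4' : m4 15 = a by [].
move: m4 r4 e4 e4' => m4 r4 e4 e4' {m3 r3 e3 h4}.
rewrite iterSr (step_fetch _ _ _ h5) /exec -[(o + 1 + 1 + 1 + 1).+1]addn1 e4 e4' -!(addnA o).
exists (upd m4 7 (8 * cell s 0 i + a)); last by [].
by split; [exact: sc | rewrite /upd eqxx].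
Qed.

(** The compiled loop tests its counter after the body and so runs at least once, which agrees with
    [sem] because [0 < N]. As register 0 is kept, every loop starts from the same [N]. *)
Lemma compile_correct N c P o s :
  wf_cmd c -> keeps 0 c -> 0 < N -> cell s 0 0 = N -> code_at P o (compile o c) ->
  runs_within P (time_bound N c) o (o + code_size c) s (sem N c s).
Proof.
move=> wf kp N0.
elim: c o s wf kp =>
  [|i v|i j k|i j k|a i j|a i j|i|i|c1 IH1 c2 IH2|i c1 IH1 c2 IH2|i c1 IH] o s.
- by rewrite addn0 => *; apply: runs_within_refl.
- move=> _ _ _ /code_at_cons[h _]; apply: (runs_within_instr h) => m rm.
  eexists; last by rewrite /= addn1.
  by rewrite -[8 * i]addn0; apply: represents_put.
- move=> _ _ _ /code_at_cons[h _]; apply: (runs_within_instr h) => m rm.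
  eexists; last by rewrite /= addn1.
  by rewrite -[8 * i]addn0 !(represents_reg _ rm); apply: represents_put.
- move=> _ _ _ /code_at_cons[h _]; apply: (runs_within_instr h) => m rm.
  eexists; last by rewrite /= addn1.
  by rewrite -[8 * i]addn0 !(represents_reg _ rm); apply: represents_put.
- move=> wf _ _ /code_at_cat[hc /code_at_cons[h _]] m rm.
  have [m' [rm' e7] e] := exec_address_code hc rm.
  eexists 6, _; split=> //; last first.
    by rewrite iterS e (step_fetch _ _ _ h) /= -addn1 -addnA.
  by rewrite -[8 * i]addn0 e7 rm' //; apply: represents_put.
- move=> wf _ _ /code_at_cat[hc /code_at_cons[h _]] m rm.
  have [m' [rm' e7] e] := exec_address_code hc rm.
  eexists 6, _; split=> //; last first.
    by rewrite iterS e (step_fetch _ _ _ h) /= -addn1 -addnA.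
  by rewrite e7 (represents_reg _ rm'); apply: represents_put.
- move=> _ _ _ /code_at_cons[h _]; apply: (runs_within_instr h) => m rm.
  eexists; last by rewrite /= addn1.
  by rewrite -[8 * i]addn0; apply: represents_put.
- move=> _ _ _ /code_at_cons[h _]; apply: (runs_within_instr h) => m rm.
  exists m => //=; by rewrite addn1 (represents_reg _ rm).
- move=> /= /andP[w1 w2] /andP[k1 k2] s0 /code_at_cat[h1 h2].
  rewrite size_compile in h2.
  apply: runs_within_trans (IH1 _ _ w1 k1 s0 h1) _; rewrite addnA.
  by apply: IH2 => //; rewrite sem_keeps.
- move=> /= /andP[w1 w2] /andP[k1 k2] s0 /code_at_cons[hj /code_at_cat[h2]].
  rewrite size_compile => /code_at_cons[hc /code_at_cons[hj' h1]].
  case: ifP => hi.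
    have r1 : runs_within P 1 o (o + code_size c2 + 3) s s.
      apply: (runs_within_instr hj) => m rm; exists m => //=.
      by rewrite (represents_reg _ rm) hi.
    apply: (@runs_within_leq _ (1 + time_bound N c1)); first lia.
    apply: runs_within_trans r1 _.
    have -> : o + (code_size c1 + code_size c2 + 3) =
              o + code_size c2 + 3 + code_size c1 by lia.
    apply: IH1 => //; move: h1.
    by have -> : o + 1 + code_size c2 + 1 + 1 = o + code_size c2 + 3 by lia.
  have r1 : runs_within P 1 o (o + 1) s s.
    apply: (runs_within_instr hj) => m rm; exists m => //=.
    by rewrite (represents_reg _ rm) hi addn1.
  apply: (@runs_within_leq _ (1 + (time_bound N c2 + 2))); first lia.
  apply: runs_within_trans r1 _.
  apply: runs_within_trans (IH2 _ _ w2 k2 s0 h2) _ => m rm.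
  eexists 2, _; split=> //; last first.
    rewrite /iter (step_fetch _ _ _ hc) /= -addn1 (step_fetch _ _ _ hj') /=.
    congr State; lia.
  exact: (represents_scratch 0).
move=> /= /andP[ki w1] /andP[i0 k1] s0 /code_at_cons[h1 /code_at_cons[h2]].
move=> /code_at_cons[h3 /code_at_cons[h4]] /code_at_cat[hc].
rewrite size_compile -!addnA => /code_at_cons[h5 _].
rewrite -!addnA /= in h1 h2 h3 h4 hc h5.
apply: (@runs_within_trans _ _ _ _ (o + 2) _ _ (put s 0 i N)).
  move=> m rm; eexists 2, _; split=> //; last first.
    rewrite /iter (step_fetch _ _ _ h1) /= -addn1 (step_fetch _ _ _ h2) /=.
    by rewrite -addn1 -addnA.
  rewrite -[8 * i]addn0.
  have -> : upd m 7 0 0 + upd m 7 0 7 = N.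
    by rewrite /upd /= addn0 -s0 -(represents_reg 0 rm) muln0.
  by apply: represents_put => //; exact: (represents_scratch 0).
have : cell (put s 0 i N) 0 0 = N.
  by rewrite cell_put /= eq_sym (negPf i0).
have : cell (put s 0 i N) 0 i = N by rewrite cell_put !eqxx.
(* Induction on the remaining iterations [n], the current value of the counter; register 0 and the
   loop body keep the original [N]. *)
move: (put s 0 i N) => s1; move: {1 2 4 6}N N0 => n.
elim: n s1 => // n IHn s1 _; rewrite iterSr => si s10.
set s2 := put s1 _ _ _; set s3 := sem N c1 s2.
have s20 : cell s2 0 0 = N by rewrite cell_put /= eq_sym (negPf i0).
have s2i : cell s2 0 i = n by rewrite cell_put /= eqxx si subn1.
have r12 : runs_within P 2 (o + 2) (o + 4) s1 s2.
  move=> m rm; eexists 2, _; split=> //; last first.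
    rewrite /iter (step_fetch _ _ _ h3) /= -addn1 -addnA (step_fetch _ _ _ h4) /=.
    by rewrite -addn1 -addnA.
  rewrite -[8 * i]addn0.
  have -> : upd m 7 1 (8 * i + 0) - upd m 7 1 7 = cell s1 0 i - 1.
    rewrite /upd /=.
    by have -> : (8 * i + 0 == 7) = false by [lia]; rewrite (rm 0).
  by apply: represents_put => //; exact: (represents_scratch 0).
have r23 := IH _ _ w1 k1 s20 hc.
have s30 : cell s3 0 0 = N by rewrite sem_keeps.
have s3i : cell s3 0 i = n by rewrite sem_keeps.
have r34 : runs_within P 1 (o + 4 + code_size c1)
    (if 0 < n then o + 2 else o + (code_size c1 + 5)) s3 s3.
  apply: (@runs_within_instr _ (IJpos (8 * i) (o + 2))).
    by rewrite -h5; congr onth; lia.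
  move=> m rm; exists m => //=; rewrite (represents_reg _ rm) s3i.
  by case: ifP => // _; congr State; lia.
have r14 := runs_within_trans (runs_within_trans r12 r23) r34.
case: n IHn s2i s3i r34 r14 {si} => [|n] IHn s2i s3i r34 r14.
  by apply: runs_within_leq r14; lia.
apply: (runs_within_leq _ (runs_within_trans r14 (IHn s3 isT s3i s30))); lia.
Qed.

(** * Optimality of the greedy cuts *)

Lemma leq_sum_subpred (I : finType) (A B : pred I) (f g : I -> nat) :
  (forall i, A i -> B i) -> (forall i, A i -> f i <= g i) ->
  \sum_(i | A i) f i <= \sum_(i | B i) g i.
Proof.
move=> AB fg; rewrite big_mkcond [leqRHS]big_mkcond; apply: leq_sum => i _.
by case: (boolP (A i)) => // Ai; rewrite (AB _ Ai) fg.
Qed.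

Section RootedTree.
Variables (T : finType) (root : T) (par : T -> T) (dep : T -> nat).
Hypothesis depP : forall v, v != root -> dep v = (dep (par v)).+1.

(** Depth grows from parent to child and is bounded on a finite type, so [\max_y dep y - dep x] is a
    decreasing measure. *)
Lemma leaves_up_ind (P : T -> Prop) :
  (forall x, (forall y, y != root -> par y = x -> P y) -> P x) ->
  forall x, P x.
Proof.
move=> IH x; have [k] := ubnP (\max_y dep y - dep x).
elim: k x => // k IHk x lt; apply: IH => y /depP ey e; apply: IHk.
have := @leq_bigmax T dep y; rewrite ey e.
move: lt; lia.
Qed.

(** * Weights of the components left by a set of cuts *)

Section Residual.
Variables (dq q : nat).

(* A set [F] of cut vertices contains the root and the vertices whose parent
   edge is cut; [residual F x] is the weight of the part of the component of
   [x] that lies at or below [x]. *)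

Fixpoint residual_fuel (k : nat) (F : {set T}) (x : T) : nat :=
  dq + if k is k'.+1 then
         \sum_(y | (par y == x) && (y \notin F)) residual_fuel k' F y
       else 0.

Definition residual (F : {set T}) (x : T) : nat :=
  residual_fuel (\max_y dep y - dep x) F x.

(** The fuel drops by one per generation and is 0 only at vertices without uncut children. Since the
    root is in [F], the arbitrary value [par root] does not turn it into a child. *)
Lemma residualE (F : {set T}) x : root \in F ->
  residual F x = dq + \sum_(y | (par y == x) && (y \notin F)) residual F y.
Proof.
move=> rF; rewrite {1}/residual.
have dy y : (par y == x) && (y \notin F) ->
    (\max_y dep y - dep x) = (\max_y dep y - dep y).+1.
  move=> /andP[/eqP<- yF].
  have /depP ey : y != root by apply: contraNneq yF => ->.
  have := @leq_bigmax T dep y; rewrite ey; lia.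
case E: (\max_y dep y - dep x) => [|k] /=; congr (_ + _).
  by rewrite big1 // => y /dy; rewrite E.
apply: eq_bigr => y /dy; rewrite E => -[->] //.
Qed.

Definition feasible (F : {set T}) : bool :=
  (root \in F) && [forall x, residual F x <= q].

Lemma residual_antimono (F F' : {set T}) x :
  root \in F -> F \subset F' -> residual F' x <= residual F x.
Proof.
move=> rF sFF'; have rF' := subsetP sFF' _ rF.
elim/leaves_up_ind: x => x IH; rewrite !residualE // leq_add2l.
have sub y : y \notin F' -> y \notin F by apply: contra; exact: (subsetP sFF').
apply: leq_sum_subpred => y /andP[e /sub yF]; first by rewrite e.
by apply: IH; [apply: contraNneq yF => -> | exact/eqP].
Qed.

(* Every vertex hangs below exactly one cut vertex. *)
Lemma residual_total (F : {set T}) : root \in F ->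
  \sum_(x in F) residual F x = dq * #|T|.
Proof.
move=> rF; apply/eqP.
rewrite -(eqn_add2r (\sum_(x | x \notin F) residual F x)).
have <- : \sum_x residual F x =
    \sum_(x in F) residual F x + \sum_(x | x \notin F) residual F x.
  by rewrite (bigID (mem F)).
(* Summed over all vertices, the recursion counts each uncut vertex once, under its parent. *)
rewrite (eq_bigr _ (fun x _ => residualE x rF)) big_split /= sum_nat_const mulnC.
rewrite eqn_add2l [eqbRHS](partition_big par predT) //=; apply/eqP.
by apply: eq_bigr => x _; apply: eq_bigl => y; rewrite andbC.
Qed.

(** The vertices outside [V] are cut and have no uncut children, so each accounts for exactly [dq]
    of the total weight. *)
Lemma residual_local_total (F V : {set T}) : root \in F ->
  (forall y, y \notin F -> (y \in V) && (par y \in V)) ->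
  \sum_(x in F :&: V) residual F x = dq * #|V|.
Proof.
move=> rF h; have := residual_total rF.
rewrite (big_setID V) /= [X in _ + X = _](_ : _ = dq * #|~: V|).
  by rewrite -(cardsC V) mulnDr => /addIn.
have -> : F :\: V = ~: V.
  apply/setP => x; rewrite !inE; case: (boolP (x \in V)) => //= xV.
  by apply: contraNT xV => /h /andP[].
rewrite mulnC -sum_nat_const; apply: eq_bigr => x; rewrite inE => xV.
rewrite residualE // big_pred0 ?addn0 // => y.
by apply: contraNF xV => /andP[/eqP<- /h /andP[]].
Qed.

(** All vertices deeper than [y] are in [D], where [F] cuts exactly the vertices of [C]. Hence
    [residual F] and [w] obey the same recursion from [y] downwards. *)
Lemma residual_settled (F D C : {set T}) (w : T -> nat) y :
  root \in F -> F :&: D = C ->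
  (forall x, w x = dq + \sum_(z | (par z == x) && (z \in D :\: C)) w z) ->
  (forall z, dep y < dep z -> z \in D) -> residual F y = w y.
Proof.
move=> rF FD wE; elim/leaves_up_ind: y => y IH hy.
rewrite residualE // wE; congr (_ + _).
have H z : (par z == y) && (z \notin F) -> z != root /\ dep z = (dep y).+1.
  move=> /andP[/eqP<- zF].
  by have nz : z != root; [apply: contraNneq zF => -> | rewrite depP].
transitivity (\sum_(z | (par z == y) && (z \notin F)) w z).
  apply: eq_bigr => z hz; have [nz dz] := H _ hz.
  case/andP: hz => /eqP e _; apply: IH => // t; rewrite dz => lt.
  by apply: hy; exact: ltnW.
apply: eq_bigl => z; rewrite -FD !inE.
case: eqP => //= e; case: (boolP (z \in F)) => //= [|zF]; first by case: (_ \in D).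
by rewrite (hy z) // (H z _).2 ?e ?eqxx.
Qed.

(* [D] is the set of treated vertices, [C] the set of cut ones among them. *)
Record greedy_inv (D C : {set T}) (w : T -> nat) : Prop := GreedyInv {
  gi_root : root \notin D;
  gi_sub : C \subset D;
  gi_closed : forall x y, x \in D -> dep x < dep y -> y \in D;
  gi_weight : forall x,
    w x = dq + \sum_(y | (par y == x) && (y \in D :\: C)) w y;
  gi_opt : exists F, [/\ feasible F, F :&: D = C &
    forall F', feasible F' -> #|F| <= #|F'|] }.

(** * The greedy steps preserve optimality *)

Lemma greedy_init : dq <= q -> greedy_inv set0 set0 (fun=> dq).
Proof.
move=> le; split; rewrite ?inE ?sub0set //.
- by move=> x y; rewrite inE.
- by move=> x; rewrite big1 ?addn0 // => y; rewrite !inE !andbF.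
(* Cutting every edge leaves single vertices of weight [dq <= q], so a minimum feasible set
   exists. *)
have fT : feasible setT.
  rewrite /feasible inE; apply/forallP => x; rewrite residualE ?inE //.
  by rewrite big1 ?addn0 // => y; rewrite !inE !andbF.
case: (arg_minnP (fun F : {set T} => #|F|) fT) => F fF min.
by exists F; rewrite setI0.
Qed.

Definition selected (D : {set T}) (w : T -> nat) (v : T) : Prop :=
  [/\ v \notin D, v != root, forall y, y \notin D -> dep y <= dep v
    & forall y, y \notin D -> dep y = dep v -> w v <= w y].

Lemma selected_closed D C w v : greedy_inv D C w -> selected D w v ->
  forall x y, x \in v |: D -> dep x < dep y -> y \in v |: D.
Proof.
move=> gi [vD _ hd _] x y; rewrite !inE => /orP[/eqP->|xD] lt; apply/orP; right.
  by apply: contraLR lt => /hd; rewrite -leqNgt.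
exact: (gi_closed gi xD lt).
Qed.

(** The optimal set [F] of the invariant already contains [v]. Otherwise [par v] would keep [v]
    together with all its merged children, and its residual would be at least [w (par v) + w v]. *)
Lemma greedy_cut D C w v : greedy_inv D C w -> selected D w v ->
  q < w (par v) + w v -> greedy_inv (v |: D) (v |: C) w.
Proof.
move=> gi sel over; have cl := selected_closed gi sel.
case: sel => vD vr hd _; have [rD sCD _ wE [F [fF FD min]]] := gi.
split=> //; first by rewrite !inE eq_sym negb_or vr.
- exact: setUS.
(* [v] enters both sets, so [D :\: C] is unchanged. *)
- move=> x; rewrite {1}wE; congr (_ + _); apply: eq_bigl => y; rewrite !inE.
  by case: (altP (y =P v)) => [->|]; rewrite ?(negPf vD) ?andbF.
exists F; split=> //; have /andP[rF /forallP hF] := fF.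
suff vF : v \in F by rewrite setIUr FD; congr (_ :|: _); apply/setIidPr; rewrite sub1set.
apply: contraLR over => vF; rewrite -leqNgt; apply: leq_trans (hF (par v)).
rewrite residualE // (bigD1 v) ?eqxx //= wE -addnA leq_add2l addnC.
(* A sibling of [v] has the depth of [v], which is maximal among the untreated vertices, so
   everything deeper is settled. *)
have below y : par y = par v -> y != root -> residual F y = w y.
  move=> e yr; apply: (residual_settled rF FD wE) => z.
  by rewrite depP // e -depP // => lt; apply: contraLR lt => /hd; rewrite -leqNgt.
rewrite below // leq_add2l; apply: leq_sum_subpred => y /andP[/eqP e].
  rewrite inE => /andP[yC yD]; rewrite e eqxx /=.
  by rewrite -FD inE yD andbT in yC; rewrite yC; apply: contraNneq vD => <-.
by rewrite inE => /andP[_ yD]; rewrite below //; apply: contraNneq rD => <-.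
Qed.

(** An exchange argument: [v] is traded for an untreated vertex, a sibling or the parent, which
    leaves the cuts inside [D] as they are. *)
Lemma greedy_merge_feasible D C w v F : greedy_inv D C w -> selected D w v ->
  w (par v) + w v <= q -> feasible F -> F :&: D = C -> v \in F ->
  exists F2, [/\ feasible F2, F2 :&: (v |: D) = C & #|F2| <= #|F|].
Proof.
move=> gi [vD vr hd hw] le /andP[rF /forallP hF] FD vF.
have [rD sCD cl wE _] := gi; set u := par v in le *.
have uD : u \notin D.
  by apply: contra vD => uD; apply: cl uD _; rewrite (depP vr).
have uv : u != v by apply/eqP => e; have := depP vr; rewrite -/u e; lia.
have below (F' : {set T}) y : root \in F' -> F' :&: D = C ->
    par y = u -> y != root -> residual F' y = w y.
  move=> rF' FD' e yr; apply: (residual_settled rF' FD' wE) => z.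
  by rewrite depP // e -depP // => lt; apply: contraLR lt => /hd; rewrite -leqNgt.
have swap x : x \notin D -> x != v ->
    [/\ root \in x |: F :\ v, (x |: F :\ v) :&: D = C
      & (x |: F :\ v) :&: (v |: D) = C].
  move=> xD xv; have E : (x |: F :\ v) :&: D = C.
    rewrite -FD; apply/setP => y; rewrite !inE.
    case: (altP (y =P x)) => [->|_] /=; first by rewrite (negPf xD) !andbF.
    by case: (altP (y =P v)) => [->|_] //=; rewrite (negPf vD) andbF.
  split=> //; first by rewrite !inE eq_sym (eq_sym root v) vr rF orbT.
  rewrite setIUr E; apply/setUidPr/subsetP => y; rewrite !inE.
  by case: (altP (y =P v)) => [->|] //=; rewrite ?andbF // eq_sym (negPf xv).
(* Only an inequality, because the new vertex may be cut already, for instance when [u] is the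
   root. *)
have card_swap x : #|x |: F :\ v| <= #|F|.
  rewrite (cardsD1 v F) vF cardsU1; case: (_ \notin _) => //=; lia.
(* An uncut sibling of [v] is at least as heavy as [v], so cutting it instead
   does not make the component of [u] heavier. If all siblings are cut or
   already merged, cutting [u] itself isolates a component of weight
   [w u + w v]. *)
case: (pickP [pred x | [&& par x == u, x \notin D & x \notin F]]) => [x|none] /=.
  case/and3P => /eqP xu xD xF.
  have xr : x != root by apply: contraNneq xF => ->.
  have xv : x != v by apply: contraNneq xF => ->.
  have [r2 E2 E2'] := swap _ xD xv.
  exists (x |: F :\ v); split=> //; apply/andP; split=> //.
  apply/forallP => y; apply: leq_trans (hF y).
  elim/leaves_up_ind: y => y IH; rewrite !residualE // leq_add2l.
  (* Both [v] and [x] are children of [u], so the set of uncut children changes at [u] alone. *)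
  have [->|yu] := eqVneq y u; last first.
    apply: leq_sum_subpred => z /andP[/eqP e]; rewrite !inE negb_or negb_and negbK.
      rewrite -e eqxx /= => /andP[_ /orP[/eqP zv|//]].
      by case/eqP: yu; rewrite -e zv.
    case/andP => _ /orP[/eqP zv|zF]; first by case/eqP: yu; rewrite -e zv.
    by apply: IH => //; apply: contraNneq zF => ->.
  rewrite (bigD1 v) /=; last by rewrite !inE !eqxx /= orbF eq_sym.
  rewrite [leqRHS](bigD1 x) /=; last by rewrite xu eqxx.
  apply: leq_add; first by rewrite !below //; apply: hw => //; rewrite (depP xr) (depP vr) xu.
  apply: leq_sum_subpred => z /andP[/andP[/eqP e]];
    rewrite !inE negb_or negb_and negbK => /andP[zx /orP[->//|zF] zv].
    by rewrite e eqxx zF zx.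
  by rewrite !below //; apply: contraNneq zF => ->.
have [r2 E2 E2'] := swap _ uD uv.
exists (u |: F :\ v); split=> //; apply/andP; split=> //.
(* As [u] is now cut, its new weight is not passed upwards, and no other residual increases. *)
suff H y : residual (u |: F :\ v) y <= if y == u then w u + w v else residual F y.
  by apply/forallP => y; apply: leq_trans (H y) _; case: ifP.
elim/leaves_up_ind: y => y IH; case: (altP (y =P u)) => [->|yu].
  rewrite residualE // wE -addnA leq_add2l (bigD1 v) /=; last first.
    by rewrite !inE !eqxx /= orbF eq_sym.
  rewrite addnC below // leq_add2r; apply: leq_sum_subpred => z;
    rewrite !inE => /andP[/andP[/eqP e]];
    rewrite negb_or negb_and negbK => /andP[zu /orP[->//|zF] zv].
    move: (none z); rewrite /= e eqxx /= zF andbT -FD => /negbFE zD.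
    by rewrite !inE (negPf zF) zD.
  by rewrite below //; apply: contraNneq zF => ->.
rewrite !residualE // leq_add2l.
apply: leq_sum_subpred => z; rewrite !inE negb_or negb_and negbK;
  case/and3P => /eqP e zu /orP[/eqP zv|zF]; try by case/eqP: yu; rewrite -e zv.
  by rewrite e eqxx.
have zr : z != root by apply: contraNneq zF => ->.
by have := IH z zr e; rewrite (negPf zu).
Qed.

Lemma greedy_merge D C w w' v : greedy_inv D C w -> selected D w v ->
  w (par v) + w v <= q ->
  (forall x, w' x = if x == par v then w (par v) + w v else w x) ->
  greedy_inv (v |: D) C w'.
Proof.
move=> gi sel le w'E; have clv := selected_closed gi sel.
have [rD sCD cl wE [F [fF FD min]]] := gi; have [vD vr hd hw] := sel.
have uD : par v \notin D.
  by apply: contra vD => uD; apply: cl uD _; rewrite (depP vr).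
have uv : par v != v by apply/eqP => e; have := depP vr; rewrite e; lia.
split=> //; first by rewrite !inE eq_sym negb_or vr.
- exact: subset_trans sCD (subsetUr _ _).
- move=> x; have vC : v \notin C by apply: contra vD; exact: (subsetP sCD).
  (* The only weight that changes is that of [par v], which is untreated and hence not a summand. *)
  have W y : y \in (v |: D) :\: C -> w' y = w y.
    rewrite w'E !inE => /andP[_ /orP[/eqP->|yD]].
      by rewrite eq_sym (negPf uv).
    by case: eqP => // e; rewrite e (negPf uD) in yD.
  rewrite (eq_bigr w); last by move=> y /andP[_]; exact: W.
  have [xu|xu] := eqVneq x (par v).
    rewrite w'E xu eqxx {1}wE [in RHS](bigD1 v) /= ?eqxx ?inE ?eqxx ?vC //.
    rewrite -addnA; congr (_ + _); rewrite addnC; congr (_ + _).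
    apply: eq_bigl => y; rewrite !inE; case: (altP (y =P v)) => [->|] /=.
      by rewrite (negPf vD) !andbF.
    by rewrite andbT.
  rewrite w'E (negPf xu) {1}wE; congr (_ + _); apply: eq_bigl => y.
  rewrite !inE; case: (altP (y =P v)) => [->|] //=.
  by rewrite eq_sym (negPf xu).
have [vF|vF] := boolP (v \in F); last first.
  exists F; split=> //; rewrite setIUr FD; apply/setUidPr/subsetP => y.
  by rewrite !inE => /andP[yF /eqP e]; rewrite -e yF in vF.
have [F2 [fF2 E2 le2]] := greedy_merge_feasible gi sel le fF FD vF.
by exists F2; split=> // F' /min; exact: leq_trans.
Qed.

(** Once only the root is untreated, the optimal set of the invariant is [root |: C]. It has one
    element more than [C], which gives the strict inequality. *)
Lemma greedy_final D C w : greedy_inv D C w -> (forall v, v != root -> v \in D) ->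
  feasible (root |: C) /\ forall F', feasible F' -> #|C| < #|F'|.
Proof.
case=> rD sCD _ _ [F [fF FD min]] all.
have eF : F = root |: C.
  apply/setP => x; rewrite -FD !inE; case: (altP (x =P root)) => [->|/all->] /=.
    by case/andP: fF.
  by rewrite andbT.
split; first by rewrite -eF.
move=> F' /min; rewrite eF cardsU1.
by rewrite (contra (subsetP sCD root)).
Qed.

End Residual.

(** * Density of the remaining forest and weights of its components *)

Section Graph.
Variable G : graph T.
Hypothesis VG : vertices G = [set: T].

Definition par_edge (v : T) : {set T} := [set v; par v].

Hypothesis EG : edges G = par_edge @: [set~ root].

Lemma par_neq v : v != root -> v != par v.
Proof. by move=> /depP e; apply/eqP => ev; move: e; rewrite -ev; lia. Qed.

(** Two distinct vertices with the same parent edge would be parents of each other, against their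
    depths. *)
Lemma par_edge_inj : {in [set~ root] &, injective par_edge}.
Proof.
move=> x y; rewrite !inE => xr yr e.
have : x \in par_edge y by rewrite -e !inE eqxx.
have : y \in par_edge x by rewrite e !inE eqxx.
rewrite !inE => /orP[/eqP->//|/eqP yx] /orP[/eqP->//|/eqP xy].
by have := depP xr; have := depP yr; rewrite -xy -yx; lia.
Qed.

Lemma max_density_leP (H : graph T) p q : 0 < q ->
  reflect (forall H', subgraph H' H -> q * #|edges H'| <= p * #|vertices H'|)
          (max_density H <= p%:R / q%:R)%R.
Proof.
move=> q0.
have dP (H' : graph T) :
    (density H' <= p%:R / q%:R)%R = (q * #|edges H'| <= p * #|vertices H'|).
  (* Without vertices there are no edges either, the density is 0 and both inequalities hold. *)
  rewrite /density; have [V0|V0] := posnP #|vertices H'|.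
    have -> : #|edges H'| = 0.
      apply/eqP; rewrite cards_eq0; apply/eqP/setP => e; rewrite inE.
      apply/negP => eE; move/forall_inP: (graphP H') => /(_ _ eE) /andP[se].
      by move/subset_leq_card: se; rewrite V0 leqn0 => /eqP->.
    by rewrite V0 muln0 mul0r divr_ge0 ?ler0n.
  rewrite ler_pdivrMr ?ltr0n // mulrAC ler_pdivlMr ?ltr0n //.
  by rewrite -!natrM ler_nat mulnC.
apply: (iffP idP) => [le H' s|h].
  rewrite -dP; apply: le_trans le; rewrite /max_density.
  exact: (bigmax_sup H').
apply: bigmax_le => [|H' s]; first by rewrite divr_ge0 ?ler0n.
by rewrite dP h.
Qed.

(** For a tree on [k] vertices, [q * (k - 1) <= p * k] amounts to [(q - p) * k <= q]. One direction
    adds this up over the components of a subgraph; the other applies the density bound to the part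
    of a component at or below [x]. *)
Lemma feasible_densityP (C : {set T}) p q : 0 < q -> root \notin C ->
  feasible (q - p) q (root |: C) =
  (max_density (del_edges G (par_edge @: C)) <= p%:R / q%:R)%R.
Proof.
move=> q0 rC; set dq := q - p; set F := root |: C.
have rF : root \in F by rewrite !inE eqxx.
apply/idP/max_density_leP => //.
  move=> /andP[_ /forallP hF] H /andP[_ sE].
  (* [F'] cuts every edge outside [H], so each component of [H] contains exactly one vertex of [F'],
     its top. *)
  pose F' := ~: [set y | (y != root) && (par_edge y \in edges H)].
  have rF' : root \in F' by rewrite !inE eqxx.
  have sFF' : F \subset F'.
    apply/subsetP => y; rewrite !inE negb_and negbK.
    case/orP => [->//|yC]; apply/orP; right; apply: contraT; rewrite negbK.
    by move=> /(subsetP sE); rewrite !inE imset_f.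
  have clF' y : y \notin F' -> (y \in vertices H) && (par y \in vertices H).
    rewrite !inE negbK => /andP[yr yH].
    move/forall_inP: (graphP H) => /(_ _ yH) /andP[/subsetP s _].
    by apply/andP; split; apply: s; rewrite !inE eqxx ?orbT.
  have tot := residual_local_total dq rF' clF'.
  have le : dq * #|vertices H| <= q * #|F' :&: vertices H|.
    rewrite -tot mulnC -sum_nat_const; apply: leq_sum => x _.
    exact: leq_trans (residual_antimono dq x rF sFF') (hF x).
  have cE : #|edges H| = #|~: F'|.
    rewrite -(card_in_imset (f := par_edge)); last first.
      move=> x y; rewrite !inE !negbK => /andP[xr _] /andP[yr _].
      by apply: par_edge_inj; rewrite !inE.
    congr #|pred_of_set _|; apply/setP => e; apply/idP/imsetP => [eH|].
      have /(subsetP sE) := eH; rewrite !inE EG => /andP[_ /imsetP[y]].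
      by rewrite !inE => yr ey; exists y => //; rewrite !inE negbK yr -ey.
    by case=> y; rewrite !inE negbK => /andP[_ yH] ->.
  (* In a forest the vertices number as many as the components and the edges together. *)
  have cV : #|vertices H| = #|F' :&: vertices H| + #|edges H|.
    rewrite -(cardsID F' (vertices H)) setIC cE; congr (_ + _).
    congr #|pred_of_set _|; apply/setP => y; rewrite in_setD in_setC.
    by case: (boolP (y \in F')) => //= /clF' /andP[->].
  (* With truncated subtraction [q <= p + dq] also holds when [p] exceeds [q]. *)
  have : q * #|vertices H| <= p * #|vertices H| + dq * #|vertices H|.
    by rewrite -mulnDl leq_mul2r /dq; apply/orP; right; lia.
  rewrite {1}cV mulnDr; move: le; set a := _ * _; set b := _ * _.
  set c := _ * #|edges H|; set d := p * _; lia.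
move=> hd; rewrite /feasible rF; apply/forallP => x.
pose r := [rel a b | (par a == b) && (a \notin F)].
(* [S] holds the vertices that reach [x] by climbing along uncut edges; its weight is the residual
   of [x]. *)
pose S := [set y | connect r y x].
have xS : x \in S by rewrite inE connect0.
have parS y : y \in S -> y != x -> (y \notin F) && (par y \in S).
  rewrite [y \in S]inE => /connectP[[|z s]] /=; first by move=> _ ->; rewrite eqxx.
  move=> /andP[/andP[/eqP e yF] ps] l _; rewrite yF e inE.
  by apply/connectP; exists s.
have childS y : y \notin F -> par y \in S -> y \in S.
  move=> yF; rewrite [par y \in S]inE [y \in S]inE; apply: connect_trans; apply: connect1.
  by rewrite /= eqxx.
have nroot y : y \notin F -> y != root by apply: contraNneq => ->.
have depS y : y \in S -> dep x <= dep y.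
  rewrite inE => /connectP[s]; elim: s y => [|z s IH] y /=; first by move=> _ ->.
  move=> /andP[/andP[/eqP e yF] ps] l; rewrite (depP (nroot _ yF)) e.
  by apply: leqW; apply: IH.
have SxF y : y \in S :\ x -> y \notin F.
  by rewrite in_setD1 => /andP[yx yS]; case/andP: (parS _ yS yx).
(* [F'] keeps only the edges inside [S]. As [x] is its only element in [S], [residual_local_total]
   yields the weight of [S]. *)
pose F' := ~: (S :\ x).
have rF' : root \in F'.
  by rewrite in_setC; apply: contraL rF; exact: SxF.
have tot : residual dq F' x = dq * #|S|.
  rewrite -(@residual_local_total dq F' S) //.
    have -> : F' :&: S = [set x].
      by apply/setP => y; rewrite !(in_setI, in_setC, in_setD1, in_set1);
         case: eqP => [->|] //=; rewrite ?xS // andNb.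
    by rewrite big_set1.
  move=> y; rewrite in_setC negbK in_setD1 => /andP[yx yS].
  by rewrite yS; case/andP: (parS _ yS yx).
have same y : y \in S -> residual dq F' y = residual dq F y.
  elim/leaves_up_ind: y => y IH yS; rewrite !residualE //; congr (_ + _).
  have E z : par z = y -> (z \notin F') = (z \notin F).
    move=> e; rewrite in_setC negbK; apply/idP/idP => [|zF]; first exact: SxF.
    rewrite in_setD1 childS ?e // andbT; apply/eqP => zx.
    by have := depP (nroot _ zF); have := depS _ yS; rewrite e zx; lia.
  transitivity (\sum_(z | (par z == y) && (z \notin F)) residual dq F' z).
    by apply: eq_bigl => z; case: eqP => //= /E.
  apply: eq_bigr => z /andP[/eqP e zF].
  by apply: IH; rewrite ?nroot // childS // e.
rewrite -same // tot.
have wfH : wf_graph (S, par_edge @: (S :\ x)).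
  apply/forall_inP => e /imsetP[y yS ->] /=; have yF := SxF _ yS.
  move: yS; rewrite in_setD1 => /andP[yx yS]; have /andP[_ pS] := parS _ yS yx.
  by rewrite subUset !sub1set yS pS cards2 par_neq ?nroot.
have sub : subgraph (Graph wfH) (del_edges G (par_edge @: C)).
  apply/andP; split; rewrite /vertices /edges /=; first by rewrite -/(vertices G) VG subsetT.
  apply/subsetP => e /imsetP[y /SxF yF ->]; rewrite in_setD -/(edges G) EG.
  have yr := nroot _ yF; apply/andP; split; last by rewrite imset_f // !inE.
  apply: contra yF => /imsetP[z zC].
  move/par_edge_inj => ->; rewrite !inE ?zC ?orbT //.
  by apply: contraNneq rC => <-.
have := hd _ sub; rewrite /edges /vertices /= card_in_imset; last first.
  by move=> y z /SxF/nroot yr /SxF/nroot zr; apply: par_edge_inj; rewrite !inE.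
rewrite (cardsD1 x S) xS mulnBl !mulnDr !muln1; lia.
Qed.

Lemma min_deletion_of_greedy (C : {set T}) p q : 0 < q -> root \notin C ->
  feasible (q - p) q (root |: C) ->
  (forall F', feasible (q - p) q F' -> #|C| < #|F'|) ->
  min_edge_deletion_bounded_density G (p%:R / q%:R)%R (par_edge @: C).
Proof.
move=> q0 rC fC min; have sC : C \subset [set~ root].
  by apply/subsetP => x xC; rewrite !inE; apply: contraNneq rC => <-.
split.
  split; first by rewrite EG imsetS.
  by rewrite -feasible_densityP.
move=> F' [sF' dF']; pose C' := [set v in [set~ root] | par_edge v \in F'].
have eF' : F' = par_edge @: C'.
  apply/setP => e; apply/idP/imsetP => [eF|[v]]; last by rewrite inE => /andP[_ vF] ->.
  have := subsetP sF' _ eF; rewrite EG => /imsetP[v vr ev].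
  by exists v => //; rewrite inE vr -ev.
have sC' : C' \subset [set~ root] by apply/subsetP => x; rewrite inE => /andP[].
have rC' : root \notin C' by rewrite !inE eqxx.
have injC (B : {set T}) : B \subset [set~ root] -> #|par_edge @: B| = #|B|.
  by move=> /subsetP s; apply: card_in_imset => x y /s xr /s yr; exact: par_edge_inj.
rewrite eF' !injC // -ltnS; rewrite eF' in dF'.
have := min (root |: C'); rewrite feasible_densityP // => /(_ dF').
by rewrite cardsU1 rC'.
Qed.

End Graph.
End RootedTree.

(** The parent edges already connect all vertices through the root, so any further edge would close
    a cycle with a path of parent edges. *)
Lemma tree_par_edges (T : finType) (G : graph T) root par dep :
  is_tree G -> vertices G = [set: T] ->
  (forall v, v != root -> dep v = (dep (par v)).+1) ->
  (forall v, v != root -> par_edge par v \in edges G) ->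
  edges G = par_edge par @: [set~ root].
Proof.
move=> [_ acy] VG depP parE; apply/setP => e.
apply/idP/imsetP => [eE|[v]]; last by rewrite !inE => /parE vE ->.
move/forall_inP: (graphP G) => /(_ _ eE) /andP[_ /cards2P[x [y [xy exy]]]].
pose r := [rel a b | (a != root) && (b == par a) || (b != root) && (a == par b)].
have rsym : symmetric r by move=> a b; rewrite /= orbC.
have radj : subrel r (adj G).
  move=> a b /orP[] /andP[ar /eqP->]; rewrite /adj; last rewrite setUC; exact: parE.
have toroot v : connect r v root.
  have [k] := ubnP (dep v); elim: k v => // k IH v lt.
  have [->|vr] := eqVneq v root; first exact: connect0.
  apply: connect_trans (IH (par v) _); last by move: lt; rewrite depP.
  by apply: connect1; rewrite /= vr eqxx.
have : connect r x y.
  by apply: connect_trans (toroot x) _; rewrite (sym_connect_sym rsym) toroot.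
case/connectP => s0 /shortenP[s ps us _] ey.
(* Cycles need at least three vertices. A path with fewer is a single parent edge, which is then [e]
   itself. *)
have [/=|sz] := boolP (2 < size (x :: s)); last first.
  case: s ps us ey sz => [|z [|t s]] //=; first by move=> _ _ ey; rewrite ey eqxx in xy.
  move=> /andP[rxz _] _ ey _; move: rxz; rewrite -ey /= => /orP[]/andP[ar /eqP ea].
    by exists x; rewrite ?inE // exy ea.
  by exists y; rewrite ?inE // exy ea setUC.
move=> sz; case: (acy (x :: s) sz); apply/andP; split=> //=.
rewrite rcons_path (sub_path radj ps) /= -ey /adj setUC -exy.
exact: eE.
Qed.

(** * The program and its correctness *)

Notation "c1 ;; c2" := (CSeq c1 c2) (at level 61, right associativity).

(* Register 0 holds [n], 1 and 2 are loop counters, 3 holds [q], 4 holds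
   [q - p], 9 and 14 hold the constants 1 and 0. Arrays 1 and 2 hold the
   endpoints of the edges, 3 the depth of a vertex (0 if it is not visited yet
   or already treated by the greedy phase), 4 its parent, and 5 the weight of
   the component hanging from it. *)

Definition setup_code : cmd :=
  CRead 5 ;; CRead 4 ;; CRead 3 ;; CSub 4 3 4 ;; CConst 9 1 ;; CConst 14 0 ;;
  CStore 3 14 9.

(** The counter runs downwards, so the edges are stored in reverse order. Rounds after the end of
    the input store the pair (0, 0), whose endpoints are both the root; [relax_code] does nothing on
    it. *)
Definition read_edge_code : cmd :=
  CRead 5 ;; CRead 6 ;; CStore 1 1 5 ;; CStore 2 1 6 ;; CStore 5 1 4.

Definition relax_code : cmd :=
  CLoad 1 5 2 ;; CLoad 2 6 2 ;; CLoad 3 7 5 ;; CLoad 3 8 6 ;;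
  CIf 7 (CIf 8 CSkip (CStore 4 6 5 ;; CAdd 7 7 9 ;; CStore 3 6 7))
        (CIf 8 (CStore 4 5 6 ;; CAdd 8 8 9 ;; CStore 3 5 8) CSkip).

(** Register 13 ends up positive exactly if vertex [R_2] is deeper than the candidate [R_10], or
    equally deep and lighter. *)
Definition scan_code : cmd :=
  CLoad 3 7 2 ;; CLoad 5 8 2 ;; CSub 5 7 11 ;; CSub 6 11 7 ;; CSub 13 12 8 ;;
  CIf 6 (CConst 13 0) CSkip ;; CAdd 13 13 5 ;;
  CIf 13 (CAdd 10 2 14 ;; CAdd 11 7 14 ;; CAdd 12 8 14) CSkip.

Definition select_code : cmd :=
  CConst 10 0 ;; CLoad 3 11 10 ;; CLoad 5 12 10 ;; CFor 2 scan_code.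

(** The root has depth 1 and treated vertices have entry 0, so [R_11 - 1] is positive only if there
    is an edge to decide on. *)
Definition treat_code : cmd :=
  CSub 5 11 9 ;;
  CIf 5 (CLoad 4 6 10 ;; CLoad 5 7 6 ;; CAdd 7 7 12 ;; CSub 8 7 3 ;;
         CIf 8 (CPrint 10 ;; CPrint 6) (CStore 5 6 7)) CSkip ;;
  CStore 3 10 14.

Definition deletion_code : cmd :=
  setup_code ;; CFor 1 read_edge_code ;; CFor 1 (CFor 2 relax_code) ;;
  CFor 1 (select_code ;; treat_code).

(** The translated code must not change register 0, so [n] is read before it, and the code starts at
    address 1. *)
Definition deletion_program : program := IRead 0 :: compile 1 deletion_code.

Lemma deletion_program_correct n x t : 0 < n ->
  (time_bound n deletion_code).+1 <= t -> exists s,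
  [/\ forall i, cell s 0 i = if i == 0 then n else 0,
      forall a i, a != 0 -> cell s a i = 0, sinp s = x, sout s = [::] &
      outputs_within deletion_program (n :: x) t
        (sout (sem n deletion_code s))].
Proof.
move=> n0 le_t; pose z := Store (fun _ _ => 0) x [::].
exists (put z 0 0 n); split=> //.
  by move=> a i /negPf a0; rewrite storeE a0.
set s := put z 0 0 n; set c := deletion_code; set P := deletion_program.
have [] := @compile_correct n c P 1 s isT isT n0 erefl _ (upd (fun=> 0) 0 n).
- by move=> k hk; rewrite add1n.
- exact: (@represents_put _ z 0 0 n).
move=> t1 [m' [le rep e]]; rewrite /outputs_within.
set st := State _ m' _ _ in e.
have h : halted P st.
  by rewrite /halted /P /deletion_program -cat1s size_cat size_compile.
(* A halted state is fixed by [step], so every time limit beyond the actual running time is good. *)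
have fixed k : iter k (step P) st = st.
  by elim: k => // k IH; rewrite iterS IH /step onth_default.
have -> : t = t - t1.+1 + (t1 + 1) by move: le_t le; rewrite -/c; lia.
rewrite iterD iterD.
have -> : iter 1 (step P) (init (n :: x)) =
    State 1 (upd (fun=> 0) 0 n) (sinp s) (sout s) by [].
by rewrite e fixed.
Qed.

(** Loops are nested at most twice, so the bound is quadratic and the constant 1000 is generous. *)
Lemma time_bound_deletion_code n : 0 < n ->
  (time_bound n deletion_code).+1 <= 1000 * n ^ 3.
Proof.
move=> n0; rewrite /deletion_code /= !expnS expn0; nia.
Qed.

(** * Distances from the root and the number of edges of a tree *)

Lemma connected_distance (T : finType) (G : graph T) (root : T) :
  (forall v, connect (adj G) root v) ->
  exists (par : T -> T) (dep : T -> nat), forall v, v != root ->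
    dep v = (dep (par v)).+1 /\ par_edge par v \in edges G.
Proof.
move=> conn.
(* [W v k] asks for a walk of length exactly [k] to [v]. The least such [k] is the depth, and the
   last but one vertex of a shortest walk can serve as parent. *)
pose W v k := [exists p : k.-tuple T, path (adj G) root p && (last root p == v)].
have exW v : exists k, W v k.
  have /connectP[p pp ev] := conn v; exists (size p).
  by apply/existsP; exists (in_tuple p); rewrite pp ev eqxx.
pose dep v := ex_minn (exW v).
have WS x v k : W x k -> adj G x v -> W v k.+1.
  case/existsP => p /andP[pp /eqP l] a.
  by apply/existsP; exists [tuple of rcons p v]; rewrite rcons_path pp l a last_rcons eqxx.
have step v : v != root -> exists x, adj G x v && (dep v == (dep x).+1).
  move=> vr; rewrite {1}/dep; case: ex_minnP => -[|k].
    by case/existsP => p; rewrite tuple0 /= => /eqP e; rewrite -e eqxx in vr.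
  case/existsP => -[p sp] /= pv min; case/lastP: p => [|p y] in sp pv *; first by [].
  move: pv; rewrite rcons_path last_rcons => /andP[/andP[pp a] /eqP yv].
  rewrite size_rcons eqSS in sp.
  exists (last root p); rewrite -yv a /= eqSS eqn_leq.
  rewrite /dep; case: ex_minnP => d Wd mind; apply/andP; split.
    by rewrite -ltnS; apply: min; apply: WS Wd _; rewrite -yv.
  by apply: mind; apply/existsP; exists (Tuple sp); rewrite pp /=.
pose par v := odflt root [pick x | adj G x v && (dep v == (dep x).+1)].
exists par, dep => v vr; rewrite /par_edge /par.
case: pickP => [x /andP[a /eqP e]|no] /=; first by split=> //; rewrite setUC.
by have [x] := step v vr; rewrite no.
Qed.

(** Ensures that the [n] rounds of the reading loop take in the whole edge list. *)
Lemma tree_card_edges (T : finType) (G : graph T) (root : T) :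
  is_tree G -> vertices G = [set: T] -> #|edges G| <= #|T|.
Proof.
move=> tG VG; have [[_ conn] _] := tG.
have [v|par [dep h]] := connected_distance (G := G) (root := root).
  by apply: conn; rewrite VG inE.
rewrite (tree_par_edges tG VG (fun v vr => (h v vr).1) (fun v vr => (h v vr).2)).
exact: leq_trans (leq_imset_card _ _) (max_card _).
Qed.

(** * Reading the edges and rooting the tree *)

Lemma read_edges_correct n (l : seq (nat * nat)) s :
  sinp s = flatten [seq [:: e.1; e.2] | e <- l] ->
  let s' := sem n (CFor 1 read_edge_code) s in
  forall j, j < n ->
    [/\ cell s' 1 j = (nth (0, 0) l (n - j.+1)).1,
        cell s' 2 j = (nth (0, 0) l (n - j.+1)).2
      & cell s' 5 j = cell s 0 4].
Proof.
move=> inp.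
pose I r s' :=
  [/\ cell s' 0 4 = cell s 0 4,
      sinp s' = flatten [seq [:: e.1; e.2] | e <- drop (n - r) l]
    & forall j, r <= j < n ->
      [/\ cell s' 1 j = (nth (0, 0) l (n - j.+1)).1,
          cell s' 2 j = (nth (0, 0) l (n - j.+1)).2
        & cell s' 5 j = cell s 0 4]].
suff : I 0 (sem n (CFor 1 read_edge_code) s) by case=> _ _ h j lt; exact: h.
apply: sem_for => //.
- by split; rewrite ?storeE ?subnn ?drop0 // => j; case: leqP.
- move=> r s' rn r1 [s4 inp' h].
  have E : [/\ head 0 (sinp s') = (nth (0, 0) l (n - r.+1)).1,
      head 0 (behead (sinp s')) = (nth (0, 0) l (n - r.+1)).2 &
      behead (behead (sinp s')) =
        flatten [seq [:: e.1; e.2] | e <- drop (n - r) l]].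
    rewrite inp'; have [lt|ge] := ltnP (n - r.+1) (size l).
      rewrite (drop_nth (0, 0) lt) /=; split=> //.
      by have -> : (n - r.+1).+1 = n - r by lia.
    by rewrite nth_default // !drop_oversize //; lia.
  case: E => h1 h2 h3; split; [by rewrite /= !storeE | by rewrite /= !storeE |].
  move=> j /andP[rj jn]; rewrite !storeE /= r1 h1 h2 s4.
  have [<-|nj] := eqVneq j r; first by rewrite ?eqxx.
  by apply: h; lia.
Qed.

Section Verification.
Variables (n : nat) (G : graph 'I_n) (root : 'I_n).
Hypothesis root0 : root = 0 :> nat.

(** Invariant of the search: the vertices of positive depth form a partial tree hanging from the
    root. *)
Record rooting (A B : nat -> nat) (s : store) : Prop := Rooting {
  rt_fst : forall j, cell s 1 j = A j;
  rt_snd : forall j, cell s 2 j = B j;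
  rt_one : cell s 0 9 = 1;
  rt_root : cell s 3 root = 1;
  rt_par : forall v : 'I_n, 0 < cell s 3 v -> v != root -> exists u : 'I_n,
    [/\ cell s 4 v = u, cell s 3 v = (cell s 3 u).+1, 0 < cell s 3 u
      & [set v; u] \in edges G] }.

Definition stores_edges (A B : nat -> nat) : Prop :=
  (forall j, j < n -> (A j = 0 /\ B j = 0) \/
     exists x y : 'I_n, [/\ A j = x, B j = y & [set x; y] \in edges G]) /\
  (forall x y : 'I_n, [set x; y] \in edges G -> exists2 j, j < n &
     (A j = x /\ B j = y) \/ (A j = y /\ B j = x)).

Lemma rooting_put A B s i v : i != 9 -> rooting A B s -> rooting A B (put s 0 i v).
Proof.
move=> i9 [h1 h2 h3 h4 h5].
by split=> //; rewrite storeE eq_sym (negPf i9).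
Qed.

Lemma rooting_visit A B s (x y : 'I_n) s' : rooting A B s ->
  0 < cell s 3 x -> cell s 3 y = 0 -> [set x; y] \in edges G ->
  (forall j, cell s' 1 j = A j) -> (forall j, cell s' 2 j = B j) ->
  cell s' 0 9 = 1 ->
  (forall i, cell s' 3 i = if i == y then (cell s 3 x).+1 else cell s 3 i) ->
  (forall i, cell s' 4 i = if i == y then val x else cell s 4 i) ->
  rooting A B s'.
Proof.
move=> rs dx dy xy h1 h2 h9 h3 h4.
have [_ _ _ r0 hp] := rs.
have val_ord_eq (a b : 'I_n) : (val a == val b) = (a == b) by [].
split=> //.
  by rewrite h3; case: eqP => // e; rewrite e dy in r0.
move=> v; rewrite h3 h4 val_ord_eq.
have dx' : cell s' 3 x = cell s 3 x.
  by rewrite h3; case: eqP => // e; rewrite e dy in dx.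
have [-> _ _|vy dv vr] := eqVneq v y.
  by exists x; rewrite dx' setUC.
have [u [e1 e2 e3 e4]] := hp v dv vr; exists u.
by rewrite !h3; case: eqP => // e; rewrite e dy in e3.
Qed.

Lemma relax_correct A B s (j := cell s 0 2) (s' := sem n relax_code s) :
  stores_edges A B -> rooting A B s -> j < n ->
  [/\ rooting A B s', forall v, 0 < cell s 3 v -> 0 < cell s' 3 v
    & (0 < cell s 3 (A j)) || (0 < cell s 3 (B j)) ->
      (0 < cell s' 3 (A j)) && (0 < cell s' 3 (B j))].
Proof.
move=> [sE _] rs jn; have [h1 h2 h9 hr _] := rs; rewrite root0 in hr.
have h1' i : cell s' 1 i = A i by rewrite sem_array.
have h2' i : cell s' 2 i = B i by rewrite sem_array.
have h9' : cell s' 0 9 = 1 by rewrite sem_keeps.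
have EA : cell s 1 (cell s 0 2) = A j by rewrite h1.
have EB : cell s 2 (cell s 0 2) = B j by rewrite h2.
pose t := put (put (put (put s 0 5 (A j)) 0 6 (B j)) 0 7 (cell s 3 (A j))) 0 8
  (cell s 3 (B j)).
have [t5 t6 t7 t8] : [/\ cell t 0 5 = A j, cell t 0 6 = B j,
  cell t 0 7 = cell s 3 (A j) & cell t 0 8 = cell s 3 (B j)] by [].
have t9 : cell t 0 9 = 1 by exact: h9.
have rt : rooting A B t by do 4!apply: rooting_put => //.
have [t3 t4] : (forall i, cell t 3 i = cell s 3 i) /\
  (forall i, cell t 4 i = cell s 4 i) by [].
have : s' = sem n (CIf 7 (CIf 8 CSkip (CStore 4 6 5 ;; CAdd 7 7 9 ;; CStore 3 6 7))
    (CIf 8 (CStore 4 5 6 ;; CAdd 8 8 9 ;; CStore 3 5 8) CSkip)) t.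
  rewrite /s' /relax_code; move: (CIf _ _ _) => c.
  by rewrite /= !storeE /= EA EB.
clearbody t; rewrite /= !storeE /= t5 t6 t7 t8 t9 !addn1 => Et.
have idle : s' = t -> (0 < cell s 3 (A j)) = (0 < cell s 3 (B j)) ->
    [/\ rooting A B s', forall v, 0 < cell s 3 v -> 0 < cell s' 3 v
      & (0 < cell s 3 (A j)) || (0 < cell s 3 (B j)) ->
        (0 < cell s' 3 (A j)) && (0 < cell s' 3 (B j))].
  move=> -> eAB; split=> // [v|]; first by rewrite t3.
  by rewrite !t3 eAB orbb andbb.
have visit k (x y : 'I_n) : s' = put (put (put t 4 y x) 0 k
      (cell s 3 x).+1) 3 y (cell s 3 x).+1 ->
    0 < cell s 3 x -> cell s 3 y = 0 -> [set x; y] \in edges G ->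
    [/\ rooting A B s', forall v, 0 < cell s 3 v -> 0 < cell s' 3 v
      & (0 < cell s' 3 x) && (0 < cell s' 3 y)].
  move=> es dx dy xy.
  have D i : cell s' 3 i = if i == y then (cell s 3 x).+1 else cell s 3 i.
    by rewrite es !storeE /= t3.
  have P i : cell s' 4 i = if i == y then val x else cell s 4 i.
    by rewrite es !storeE /= t4.
  split; first exact: (@rooting_visit A B s x y).
    by move=> v dv; rewrite D; case: eqP.
  by rewrite !D eqxx andbT; case: eqP.
(* A padding pair has the visited root at both ends. *)
have [[a0 b0]|[x [y [ax bY xy]]]] := sE _ jn.
  by apply: idle; rewrite ?Et a0 b0 ?hr.
rewrite ax bY in Et idle *.
have zeroVpos k : k = 0 \/ 0 < k by case: k; [left | right].
have [dx|dx] := zeroVpos (cell s 3 x); have [dy|dy] := zeroVpos (cell s 3 y);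
  rewrite dx dy /= in Et.
- by apply: idle; rewrite // dx dy.
- rewrite setUC in xy; have [r m d] := visit _ _ _ Et dy dx xy.
  by split=> // _; rewrite andbC.
- by have [r m d] := visit _ _ _ Et dx dy xy.
by apply: idle; rewrite // dx dy.
Qed.

(** As in the Bellman-Ford algorithm, after [k] passes every vertex at the end of a walk of length
    at most [k] from the root is visited; a path without repetition has fewer than [n] edges. *)
Lemma rooting_correct A B s (s' := sem n (CFor 1 (CFor 2 relax_code)) s) :
  stores_edges A B -> rooting A B s ->
  (forall v, connect (adj G) root v) ->
  rooting A B s' /\ forall v : 'I_n, 0 < cell s' 3 v.
Proof.
move=> sE rs conn.
pose I r s1 := rooting A B s1 /\ forall p : seq 'I_n, size p <= n - r ->
  path (adj G) root p -> 0 < cell s1 3 (last root p).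
suff : I 0 s'.
  case=> rs' h; split=> // v; have /connectP[p0 pp0 ->] := conn v.
  case/shortenP: pp0 => p pp up _; apply: h => //; rewrite subn0.
  have := max_card (mem (root :: p)); rewrite card_ord (card_uniqP up) /=.
  exact: ltnW.
apply: sem_for => //.
- split; first exact: rooting_put.
  move=> p; rewrite subnn leqn0 => /nilP -> _ /=.
  by rewrite storeE /= (rt_root rs).
- move=> r s1 rn _ [rs1 h1].
  (* [J] compares with the store [s1] before the pass: an edge with an endpoint visited there has
     both ends visited once it is processed. *)
  pose J k s2 := [/\ rooting A B s2, forall v, 0 < cell s1 3 v -> 0 < cell s2 3 v
    & forall j, k <= j < n -> (0 < cell s1 3 (A j)) || (0 < cell s1 3 (B j)) ->
      (0 < cell s2 3 (A j)) && (0 < cell s2 3 (B j))].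
  have : J 0 (sem n (CFor 2 relax_code) s1).
    apply: sem_for => //.
    + split; first exact: rooting_put.
        by move=> v; rewrite storeE.
      by move=> j; case: leqP.
    + move=> k s2 kn k2 [rs2 m2 h2]; have := relax_correct sE rs2.
      rewrite k2 => /(_ kn) [rs3 m3 h3]; split=> //.
        by move=> v /m2; exact: m3.
      move=> j /andP[kj jn] d; have [jk|nk] := eqVneq j k.
        rewrite jk; apply: h3; rewrite jk in d.
        by case/orP: d => /m2 ->; rewrite ?orbT.
      have /andP[a b] : (0 < cell s2 3 (A j)) && (0 < cell s2 3 (B j)).
        by apply: h2 => //; lia.
      by rewrite !m3.
    move=> k s2 v [rs2 m2 h2]; split; first exact: rooting_put.
      by move=> w; rewrite storeE; exact: m2.
    by move=> j; rewrite !storeE; exact: h2.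
  case=> rs2 m2 h2; split=> // p; case/lastP: p => [|p v].
    by move=> _ _; rewrite /= (rt_root rs2).
  rewrite size_rcons rcons_path last_rcons => sz /andP[pp a].
  have dl : 0 < cell s1 3 (last root p) by apply: h1 => //; lia.
  have [j jn e] := sE.2 _ _ a.
  have := h2 j; rewrite jn => /(_ isT).
  by case: e => [[-> ->]|[-> ->]]; rewrite dl ?orbT => /(_ isT) /andP[].
move=> r s1 v [rs1 h1]; split; first exact: rooting_put.
by move=> p sz pp; rewrite storeE; exact: h1.
Qed.

(** * Selecting and treating a vertex *)

Definition lex_best (D W : nat -> nat) (b i : nat) : Prop :=
  D i < D b \/ D i = D b /\ W b <= W i.

Lemma select_correct D W s (s' := sem n select_code s) :
  (forall i, cell s 3 i = D i) -> (forall i, cell s 5 i = W i) ->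
  cell s 0 14 = 0 ->
  [/\ cell s' 0 10 < n, cell s' 0 11 = D (cell s' 0 10),
      cell s' 0 12 = W (cell s' 0 10)
    & forall i, i < n -> lex_best D W (cell s' 0 10) i].
Proof.
move=> sD sW s14.
pose I r s1 := [/\ cell s1 0 14 = 0,
  forall i, cell s1 3 i = D i, forall i, cell s1 5 i = W i &
  [/\ cell s1 0 10 < n, cell s1 0 11 = D (cell s1 0 10),
      cell s1 0 12 = W (cell s1 0 10)
    & forall i, r <= i < n -> lex_best D W (cell s1 0 10) i]].
suff : I 0 s' by case.
have loads c : sem n (CConst 10 0 ;; CLoad 3 11 10 ;; CLoad 5 12 10 ;; c) s =
    sem n c (put (put (put s 0 10 0) 0 11 (D 0)) 0 12 (W 0)).
  by rewrite /= !storeE /= sD sW.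
rewrite /s' /select_code loads.
apply: sem_for => //.
- split=> //; rewrite !storeE /=; split=> //; first by rewrite -[X in X < _]root0.
  by move=> i; case: leqP.
- move=> r s1 rn r2 [z d w [bn bd bw best]].
  have d' i : cell (sem n scan_code s1) 3 i = D i by rewrite sem_array.
  have w' i : cell (sem n scan_code s1) 5 i = W i by rewrite sem_array.
  have z' : cell (sem n scan_code s1) 0 14 = 0 by rewrite sem_keeps.
  set b := cell s1 0 10 in bn bd bw best.
  pose take := (D b < D r) || (D b == D r) && (W r < W b).
  have : [/\ cell (sem n scan_code s1) 0 10 = if take then r else b,
             cell (sem n scan_code s1) 0 11 = if take then D r else D b
           & cell (sem n scan_code s1) 0 12 = if take then W r else W b].
    pose t := put (put (put (put (put s1 0 7 (D r)) 0 8 (W r)) 0 5 (D r - D b))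
      0 6 (D b - D r)) 0 13 (W b - W r).
    have loads_scan c : sem n (CLoad 3 7 2 ;; CLoad 5 8 2 ;; CSub 5 7 11 ;;
        CSub 6 11 7 ;; CSub 13 12 8 ;; c) s1 = sem n c t.
      by rewrite /= !storeE /= r2 d w bd bw.
    have [t2 t5 t6 t7] : [/\ cell t 0 2 = r, cell t 0 5 = D r - D b,
      cell t 0 6 = D b - D r & cell t 0 7 = D r] by [].
    have [t8 t10 t11 t12] : [/\ cell t 0 8 = W r, cell t 0 10 = b,
      cell t 0 11 = D b & cell t 0 12 = W b] by [].
    have [t13 t14] : cell t 0 13 = W b - W r /\ cell t 0 14 = 0 by [].
    rewrite /scan_code loads_scan; clearbody t.
    pose k := (if 0 < D b - D r then 0 else W b - W r) + (D r - D b).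
    have test c : exists2 t', sem n (CIf 6 (CConst 13 0) CSkip ;; CAdd 13 13 5 ;; c) t
        = sem n c t' & forall i, cell t' 0 i = if i == 13 then k else cell t 0 i.
      rewrite /= t6 /k; case: ifP => _; eexists; try reflexivity.
        by move=> i; rewrite !storeE /= t5; case: eqP.
      by move=> i; rewrite !storeE /= t5 t13.
    have [t' -> t'E] := test (CIf 13 (CAdd 10 2 14 ;; CAdd 11 7 14 ;; CAdd 12 8 14) CSkip).
    rewrite /= t'E /=; have -> : (0 < k) = take by rewrite /k /take; case: ifP; lia.
    case: take; rewrite ?storeE /= !t'E /= ?t2 ?t7 ?t8 ?t10 ?t11 ?t12 ?t14 ?addn0 //.
  case=> e10 e11 e12; split=> //; rewrite e10 e11 e12.
  split; try by case: ifP.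
  move=> i /andP[ri iN]; rewrite /lex_best.
  have [->|ir] := eqVneq i r.
    by rewrite /take; case: ifP; lia.
  have : lex_best D W b i by apply: best; lia.
  by rewrite /lex_best /take; case: ifP; lia.
Qed.

Lemma treat_correct s (b := cell s 0 10) (u := cell s 4 b)
    (sum := cell s 5 u + cell s 0 12) (q := cell s 0 3)
    (cut := (1 < cell s 0 11) && (q < sum))
    (merge := (1 < cell s 0 11) && (sum <= q)) (s' := sem n treat_code s) :
  cell s 0 9 = 1 -> cell s 0 14 = 0 ->
  [/\ forall i, cell s' 3 i = if i == b then 0 else cell s 3 i,
      forall i, cell s' 5 i = if merge && (i == u) then sum else cell s 5 i
    & sout s' = if cut then sout s ++ [:: b; u] else sout s].
Proof.
move=> s9 s14; rewrite /s' /treat_code; set body := CIf 5 _ _.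
have -> : sem n (CSub 5 11 9 ;; body ;; CStore 3 10 14) s =
    sem n (CStore 3 10 14) (sem n body (put s 0 5 (cell s 0 11 - 1))).
  by rewrite /= s9.
set t := put s _ _ _; set t' := sem n body t.
have t10 : cell t' 0 10 = b by rewrite sem_keeps.
have t14 : cell t' 0 14 = 0 by rewrite sem_keeps.
have t3 i : cell t' 3 i = cell s 3 i by rewrite sem_array.
rewrite /= t10 t14 sout_put.
suff [h5 ho] : (forall i, cell t' 5 i = if merge && (i == u) then sum else cell s 5 i)
    /\ sout t' = if cut then sout s ++ [:: b; u] else sout s.
  by split=> // i; rewrite cell_put /= ?t3.
have E : t' = if 1 < cell s 0 11 then
    sem n (CIf 8 (CPrint 10 ;; CPrint 6) (CStore 5 6 7))
      (put (put (put (put t 0 6 u) 0 7 (cell s 5 u)) 0 7 sum) 0 8 (sum - q)) else t.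
  rewrite /t' /body; move: (CIf 8 _ _) => c.
  by rewrite /= !storeE /= subn_gt0; case: ifP.
clearbody t'; rewrite E /merge /cut; case: ifP => //= _.
rewrite storeE /= subn_gt0 ltnNge; case: leqP => /= le; split=> //.
by rewrite !storeE /= -!cats1 -catA.
Qed.

End Verification.

(** * The greedy loop *)

Lemma greedy_inv_ext (T : finType) root par (dep : T -> nat) dq q D C w w' :
  w =1 w' -> greedy_inv root par dep dq q D C w -> greedy_inv root par dep dq q D C w'.
Proof.
move=> ww [h1 h2 h3 h4 h5]; split=> // x; rewrite -ww h4; congr (_ + _).
by apply: eq_bigr => y _; rewrite ww.
Qed.

Section Greedy.
Variables (n : nat) (root : 'I_n) (par : 'I_n -> 'I_n) (dep : 'I_n -> nat).
Hypothesis root0 : root = 0 :> nat.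
Hypothesis depP : forall v, v != root -> dep v = (dep (par v)).+1.
Hypothesis dep_root : dep root = 1.
Hypothesis dep_gt0 : forall v, 0 < dep v.

(** The loop eventually clears the depth entry of the root too, without deciding on an edge, so the
    root is excluded explicitly. *)
Definition treated (s : store) : {set 'I_n} :=
  [set v | (v != root) && (cell s 3 v == 0)].

(** The bound [r] on the number of nonzero depth entries guarantees that [n] rounds handle every
    vertex. [l] lists the cuts in the order of output. *)
Definition loop_inv (dq q r : nat) (s : store) : Prop :=
  [/\ [/\ cell s 0 3 = q, cell s 0 9 = 1 & cell s 0 14 = 0],
      forall v, v != root -> cell s 4 v = par v,
      forall v : 'I_n, cell s 3 v = 0 \/ cell s 3 v = dep v,
      #|[set v : 'I_n | 0 < cell s 3 v]| <= r
    & exists2 l, greedy_inv root par dep dq q (treated s) [set v in l]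
                   (fun v => cell s 5 v)
      & uniq l /\ sout s = endpoints [seq (v, par v) | v <- l]].

Lemma loop_inv_step dq q r s : loop_inv dq q r.+1 s ->
  loop_inv dq q r (sem n (select_code ;; treat_code) s).
Proof.
case=> [[s3 s9 s14] sP sD card [l gi [ul so]]].
rewrite sem_seq; set s1 := sem n select_code s.
have d1 i : cell s1 3 i = cell s 3 i by rewrite sem_array.
have p1 i : cell s1 4 i = cell s 4 i by rewrite sem_array.
have w1 i : cell s1 5 i = cell s 5 i by rewrite sem_array.
have o1 : sout s1 = sout s by rewrite sem_silent.
have q1 : cell s1 0 3 = q by rewrite sem_keeps.
have e1 : cell s1 0 9 = 1 by rewrite sem_keeps.
have z1 : cell s1 0 14 = 0 by rewrite sem_keeps.
have [bn bd bw best] := select_correct root0 (fun=> erefl) (fun=> erefl) s14.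
rewrite -/s1 in bn bd bw best.
set s2 := sem n treat_code s1.
have [d2 w2 o2] := treat_correct n e1 z1; rewrite -/s2 in d2 w2 o2.
have p2 i : cell s2 4 i = cell s 4 i by rewrite sem_array.
pose b := Ordinal bn; rewrite -[cell s1 0 10]/(val b) in bd bw best d2 w2 o2.
rewrite p1 w1 q1 bd bw o1 in w2 o2.
have d2' (v : 'I_n) : cell s2 3 v = if v == b then 0 else cell s 3 v.
  by rewrite d2 d1.
have best' (v : 'I_n) : cell s 3 v <= cell s 3 b.
  by have [/ltnW|[/eq_leq]] := best v (ltn_ord v).
have treated2 : b != root -> treated s2 = b |: treated s.
  move=> br; apply/setP => v; rewrite !inE d2'.
  by case: (eqVneq v b) => [->|] //; rewrite br.
split.
- by rewrite !sem_keeps.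
- by move=> v vr; rewrite p2 sP.
- by move=> v; rewrite d2'; case: eqP => _; [left | exact: sD].
(* If the greatest depth entry is 0, all of them are; otherwise the selected vertex drops out of the
   set. *)
- have [b0|b0] := posnP (cell s 3 b).
    rewrite eq_card0 // => v; rewrite !inE d2'.
    by have := best' v; rewrite b0 leqn0 => /eqP->; case: eqP.
  rewrite -ltnS; apply: leq_trans card; apply: proper_card.
  apply/properP; split; last by exists b; rewrite !inE ?d2' ?eqxx.
  by apply/subsetP => v; rewrite !inE d2'; case: eqP.
(* Vertices other than the root have depth at least 2, so an entry of at most 1 means that [b] is
   the root or already treated. *)
have [gt1|le1] := ltnP 1 (cell s 3 b); last first.
  rewrite ltnNge le1 /= in w2 o2; exists l; last by rewrite o2.
  have -> : treated s2 = treated s.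
    apply/setP => v; rewrite !inE d2'; have [->|] := eqVneq v b => //.
    case: (altP (b =P root)) => //= br; case: (sD b) => [->//|e].
    by have := dep_gt0 (par b); rewrite e (depP br) in le1; rewrite -ltnS ltnNge le1.
  by apply: greedy_inv_ext gi => v; rewrite w2.
have vb : cell s 3 b = dep b by case: (sD b) => // e; rewrite e in gt1.
have br : b != root by apply: contraTneq gt1 => e; rewrite vb e dep_root.
have un y : y \notin treated s -> y = root \/ cell s 3 y = dep y.
  rewrite inE negb_and negbK => /orP[/eqP->|y0]; first by left.
  by right; case: (sD y) => // e; rewrite e in y0.
have bt : b \notin treated s by rewrite inE br /= -lt0n; apply: ltnW.
have sel : selected root dep (treated s) (fun v => cell s 5 v) b.
  split=> // y /un[->|dy].
  - by rewrite dep_root -vb ltnW.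
  - by rewrite -dy -vb best'.
  - by rewrite dep_root -vb => e; rewrite -e in gt1.
  rewrite -dy -vb => e; have := best y (ltn_ord y); rewrite /lex_best e ltnn.
  by case=> // -[].
have ew2 (v : 'I_n) : cell s2 5 v = if (cell s 5 (par b) + cell s 5 b <= q) && (v == par b)
    then cell s 5 (par b) + cell s 5 b else cell s 5 v.
  by rewrite w2 gt1 sP // w1.
rewrite sP // gt1 /= in o2.
have [over|fits] := ltnP q (cell s 5 (par b) + cell s 5 b).
  rewrite over in o2; exists (rcons l b).
    rewrite treated2 //; have -> : [set v in rcons l b] = b |: [set v in l].
      by apply/setP => v; rewrite !inE mem_rcons inE.
    apply: greedy_inv_ext (greedy_cut depP gi sel over) => v.
    by rewrite ew2 leqNgt over.
  split; last by rewrite o2 so /endpoints !map_rcons flatten_rcons.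
  rewrite rcons_uniq ul andbT; apply: contra bt => bl.
  by apply: (subsetP (gi_sub gi)); rewrite inE.
exists l; last by rewrite o2 ltnNge fits.
rewrite treated2 //; apply: (greedy_merge depP gi sel fits) => v.
by rewrite ew2 fits.
Qed.

End Greedy.


(** * Composition of the phases *)

Lemma stores_edges_of_list n (G : graph 'I_n) (l : seq ('I_n * 'I_n)) A B :
  edge_list (edges G) l -> size l <= n ->
  (forall j, j < n ->
     let e := nth (0, 0) [seq (val e.1, val e.2) | e <- l] (n - j.+1) in
     A j = e.1 /\ B j = e.2) ->
  stores_edges G A B.
Proof.
move=> el sz AB; have mem_l e : (e \in edges G) = (e \in [seq [set p.1; p.2] | p <- l]).
  by rewrite (perm_mem el) mem_enum.
split=> [j jn|x y].
  have [] := AB j jn; have [ge|lt] := leqP (size l) (n - j.+1).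
    by rewrite nth_default ?size_map // => -> ->; left.
  case: l lt {el sz AB} mem_l => // p0 l lt mem_l.
  rewrite (nth_map p0) //= => -> ->; right.
  exists (nth p0 (p0 :: l) (n - j.+1)).1, (nth p0 (p0 :: l) (n - j.+1)).2.
  by split=> //; rewrite mem_l; apply/mapP; exists (nth p0 (p0 :: l) (n - j.+1));
     rewrite ?mem_nth.
rewrite mem_l => /mapP[p pl exy].
have pn : index p l < n by apply: leq_trans sz; rewrite index_mem.
exists (n - (index p l).+1); first by lia.
have [|] := AB (n - (index p l).+1); first by lia.
have -> : n - (n - (index p l).+1).+1 = index p l by lia.
rewrite (nth_map p) ?index_mem // nth_index //= => -> ->.
move: (p.1) (p.2) exy => a b exy.
have : x \in [set a; b] by rewrite -exy !inE eqxx.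
have : y \in [set a; b] by rewrite -exy !inE eqxx orbT.
have : a \in [set x; y] by rewrite exy !inE eqxx.
have : b \in [set x; y] by rewrite exy !inE eqxx orbT.
rewrite !inE => /orP[]/eqP e2 /orP[]/eqP e1 /orP[]/eqP ey /orP[]/eqP ex;
  subst; by [left | right].
Qed.

Lemma deletion_code_correct n (G : graph 'I_n) (p q m : nat) (l : seq ('I_n * 'I_n)) s :
  0 < n -> is_tree G -> vertices G = [set: 'I_n] -> edge_list (edges G) l -> 0 < q ->
  (forall a i, a != 0 -> cell s a i = 0) ->
  sinp s = [:: m; p; q] ++ endpoints l -> sout s = [::] ->
  exists2 F, encodes_edges F (sout (sem n deletion_code s)) &
    min_edge_deletion_bounded_density G (p%:R / q%:R)%R F.
Proof.
move=> n0 tG VG el q0 s0 sI sO.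
pose root := Ordinal n0; have root0 : root = 0 :> nat by [].
have sz : size l <= n.
  have := perm_size el; rewrite size_map -cardE => ->.
  by have := tree_card_edges root tG VG; rewrite card_ord.
have conn v : connect (adj G) root v by have [[_ h] _] := tG; apply: h; rewrite VG inE.
rewrite /deletion_code 3!sem_seq.
set s1 := sem n setup_code s.
have [i1 o1 s13 s14] : [/\ sinp s1 = endpoints l, sout s1 = [::], cell s1 0 3 = q
    & cell s1 0 4 = q - p] by rewrite /s1 /setup_code /= !storeE /= sI.
have [s19 s114 d1] : [/\ cell s1 0 9 = 1, cell s1 0 14 = 0
    & forall i, cell s1 3 i = (i == 0)].
  by rewrite /s1 /setup_code /= !storeE /=; split=> // i; rewrite !storeE /= s0; case: eqP.
clearbody s1.
set s2 := sem n (CFor 1 _) s1.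
have rd := @read_edges_correct n [seq (val e.1, val e.2) | e <- l] s1.
have sE : stores_edges G (cell s2 1) (cell s2 2).
  apply: stores_edges_of_list el sz _ => j jn e.
  by have [|h1 h2 _] := rd _ j jn; rewrite ?i1 /endpoints -?map_comp.
have w2 (v : 'I_n) : cell s2 5 v = q - p.
  by have [|_ _ ->] := rd _ v (ltn_ord v); rewrite ?i1 /endpoints -?map_comp.
have rs2 : rooting G root (cell s2 1) (cell s2 2) s2.
  have d2 i : cell s2 3 i = (i == 0) by rewrite sem_array // d1.
  split=> // [|v]; first by rewrite sem_keeps.
  by rewrite d2 lt0b -[_ == 0]/(v == root) => ->.
have [rs3 vis] := rooting_correct root0 sE rs2 conn.
set s3 := sem n (CFor 1 (CFor 2 _)) s2 in rs3 vis *.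
(* For [v != root] the parent cell holds a vertex, so the default of [insubd] can matter only at the
   root. *)
pose par (v : 'I_n) : 'I_n := insubd root (cell s3 4 v); pose dep (v : 'I_n) := cell s3 3 v.
have parP v : v != root -> [/\ cell s3 4 v = par v, dep v = (dep (par v)).+1
    & par_edge par v \in edges G].
  move=> vr; have [u [e1 e2 e3 e4]] := rt_par rs3 (vis v) vr.
  have eu : par v = u by apply: val_inj; rewrite /par e1 insubdK // unfold_in.
  by rewrite /par_edge eu.
have depP v : v != root -> dep v = (dep (par v)).+1 by move=> /parP[].
have EG : edges G = par_edge par @: [set~ root].
  by apply: (tree_par_edges tG VG depP) => v /parP[].
have init : loop_inv root par dep (q - p) q n s3.
  split.
  - by split; rewrite !sem_keeps.
  - by move=> v /parP[].
  - by right.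
  - by rewrite -[leqRHS]card_ord max_card.
  have -> : treated root s3 = set0.
    by apply/setP => v; rewrite !inE -leqn0 leqNgt vis andbF.
  exists [::]; last by rewrite !sem_silent.
  have -> : [set v in [::]] = set0 :> {set 'I_n} by apply/setP => v; rewrite !inE.
  apply: greedy_inv_ext (greedy_init depP (leq_subr p q)) => v.
  by rewrite sem_array.
have : loop_inv root par dep (q - p) q 0 (sem n (CFor 1 (select_code ;; treat_code)) s3).
  apply: sem_for => //.
  by move=> r s' _ _; apply: loop_inv_step => //; exact: (rt_root rs3).
(* With no round left, no depth entry is nonzero, so all vertices but the root are treated. *)
move: (sem n _ s3) => s4 [_ _ _]; rewrite leqn0 cards_eq0 => /eqP z [c gi [uc ->]].
have [|feas opt] := greedy_final gi.
  move=> v vr; rewrite inE vr /= -leqn0 leqNgt.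
  by have := in_set0 v; rewrite -z inE => ->.
have rc : root \notin [set v in c].
  by apply/negP => /(subsetP (gi_sub gi)); rewrite inE eqxx.
exists (par_edge par @: [set v in c]); last first.
  exact: (min_deletion_of_greedy depP VG EG).
exists [seq (v, par v) | v <- c] => //; rewrite /edge_list -map_comp.
apply: uniq_perm.
- rewrite map_inj_in_uniq // => x y xc yc; apply: (par_edge_inj depP); rewrite !inE.
    by apply: contraNneq rc => <-; rewrite inE.
  by apply: contraNneq rc => <-; rewrite inE.
- exact: enum_uniq.
move=> e; rewrite mem_enum; apply/mapP/imsetP => -[v vc ->]; exists v => //.
  by rewrite inE.
by rewrite inE in vc.
Qed.

Theorem theorem6 :
  exists (P : program) (f : nat -> nat),
    bigO f (fun n : nat => n ^ 3) /\
    forall (n : nat) (G : graph 'I_n) (tau : rat) (x : seq nat),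
      is_tree G -> (0 <= tau)%R -> encodes_instance G tau x ->
      exists (y : seq nat) (F : {set {set 'I_n}}),
        [/\ outputs_within P x (f n) y, encodes_edges F y
          & min_edge_deletion_bounded_density G tau F].
Proof.
exists deletion_program, (fun n => 1000 * n ^ 3); split; first by exists 1000, 0.
move=> n G tau x tG _ [VG [l [p [q [el q0 -> ->]]]]].
(* Connectedness includes having a vertex; the compiled loops rely on [0 < n]. *)
have n0 : 0 < n.
  by have [[/set0Pn[v _] _] _] := tG; exact: leq_ltn_trans (ltn_ord v).
have [s [_ s0 sI sO run]] := @deletion_program_correct n
  ([:: #|edges G|; p; q] ++ endpoints l) _ n0 (time_bound_deletion_code n0).
have [F eF mF] := deletion_code_correct n0 tG VG el q0 s0 sI sO.
by exists (sout (sem n deletion_code s)), F.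
Qed.
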